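(* Let $R$ be a commutative noetherian ring with $\dim R<\infty$. If $Y$ is a complex of flat cotorsion $R$-modules, then $Y=Y'\oplus Y''$ as complexes of $R$-modules, where $Y'$ is minimal and $Y''$ is contractible.
   Context: Complexes may be unbounded; $\dim R$ is the Krull dimension. An $R$-module $M$ is flat cotorsion if it is flat and $\operatorname{Ext}^1_R(F,M)=0$ for every flat $R$-module $F$. An $R$-complex $X$ is minimal if every homotopy equivalence $X\to X$ is an isomorphism of complexes. A complex is contractible if it is isomorphic to the zero complex in the homotopy category $\mathsf K(R)$. *)

(* Defs.v *)
From HB Require Import structures.
From mathcomp Require Import all_boot all_order all_algebra.
From mathcomp Require Import boolp classical_sets.

Set Implicit Arguments.
Unset Strict Implicit.
Unset Printing Implicit Defensive.

Import GRing.Theory.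
Local Open Scope classical_set_scope.
Local Open Scope ring_scope.
Local Open Scope quotient_scope.

(** Rings are of type [comPzRingType]: the zero ring is allowed. *)

Section Rings.
Variable R : comPzRingType.

Definition is_ideal (I : set R) : Prop :=
  I 0 /\ forall a x y, I x -> I y -> I (a * x + y).

Definition generated_by (s : seq R) : set R :=
  [set x | exists c : 'I_(size s) -> R, x = \sum_(i < size s) c i * s`_i].

Definition noetherian : Prop :=
  forall I : set R, is_ideal I -> exists s : seq R, I = generated_by s.

Definition is_prime_ideal (P : set R) : Prop :=
  [/\ is_ideal P, ~ P 1 & forall x y, P (x * y) -> P x \/ P y].

Definition krull_dim_le (n : nat) : Prop :=
  forall (m : nat) (P : nat -> set R),
    (forall i, (i <= m)%N -> is_prime_ideal (P i)) ->
    (forall i, (i < m)%N -> P i `<` P i.+1) ->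
    (m <= n)%N.

Definition finite_krull_dim : Prop := exists n : nat, krull_dim_le n.

End Rings.

(** The tensor product is the set of formal sums of pure tensors, i.e. of
    [seq (M * N)] with concatenation as addition, modulo the least congruence
    making it commutative and the pure tensors bilinear.  As [seq (M * N)] has no
    opposites, that [0 (x) y = x (x) 0 = 0] has to be required separately. *)

Section Tensor.
Variables (R : comPzRingType) (M N : lmodType R).
Implicit Types (s t u : seq (M * N)) (x : M) (y : N).

Inductive tensor_rel : seq (M * N) -> seq (M * N) -> Prop :=
| tensor_refl s : tensor_rel s s
| tensor_sym s t : tensor_rel s t -> tensor_rel t s
| tensor_trans s t u : tensor_rel s t -> tensor_rel t u -> tensor_rel s u
| tensor_cat s s' t t' :
    tensor_rel s s' -> tensor_rel t t' -> tensor_rel (s ++ t) (s' ++ t')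
| tensor_comm s t : tensor_rel (s ++ t) (t ++ s)
| tensor_addl x x' y : tensor_rel [:: (x + x', y)] [:: (x, y); (x', y)]
| tensor_addr x y y' : tensor_rel [:: (x, y + y')] [:: (x, y); (x, y')]
| tensor_scale a x y : tensor_rel [:: (a *: x, y)] [:: (x, a *: y)]
| tensor_0l y : tensor_rel [:: (0, y)] [::]
| tensor_0r x : tensor_rel [:: (x, 0)] [::].

Definition tensor_relb : rel (seq (M * N)) := fun s t => `[< tensor_rel s t >].

Lemma tensor_relb_equiv : equiv_class_of tensor_relb.
Proof.
split=> [s|s t|t s u]; first by apply/asboolP/tensor_refl.
- by apply/asboolP/asboolP => /tensor_sym.
- by move=> /asboolP h1 /asboolP h2; apply/asboolP/(tensor_trans h1 h2).
Qed.

Canonical tensor_equiv := EquivRelPack tensor_relb_equiv.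
Canonical tensor_encModRel := defaultEncModRel tensor_relb.

Definition tensor := {eq_quot tensor_relb}.

HB.instance Definition _ : EqQuotient _ tensor_relb tensor :=
  EqQuotient.on tensor.
HB.instance Definition _ := Choice.on tensor.

Lemma tensor_eqP s t : (\pi_tensor s = \pi_tensor t) <-> tensor_rel s t.
Proof.
split=> [/eqP|h]; first by rewrite piE => /asboolP.
by apply/eqP; rewrite piE; apply/asboolP.
Qed.

Lemma tensor_repr s : tensor_rel (repr (\pi_tensor s)) s.
Proof. by apply/tensor_eqP; rewrite reprK. Qed.

Definition scale_terms (a : R) s := [seq (a *: p.1, p.2) | p <- s].

Lemma scale_terms_rel a s t :
  tensor_rel s t -> tensor_rel (scale_terms a s) (scale_terms a t).
Proof.
elim=> {s t} /=.
- by move=> s; apply: tensor_refl.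
- by move=> s t _; apply: tensor_sym.
- by move=> s t u _ h1 _; apply: (tensor_trans h1).
- by move=> s s' t t' _ h1 _ h2; rewrite /scale_terms !map_cat; apply: tensor_cat.
- by move=> s t; rewrite /scale_terms !map_cat; apply: tensor_comm.
- by move=> x x' y; rewrite scalerDr; apply: tensor_addl.
- by move=> x y y'; apply: tensor_addr.
- move=> b x y; rewrite scalerA mulrC -scalerA; exact: tensor_scale.
- by move=> y; rewrite scaler0; apply: tensor_0l.
- by move=> x; apply: tensor_0r.
Qed.

Definition tensor_zero : tensor := \pi_tensor [::].
Definition tensor_add (p q : tensor) : tensor := \pi_tensor (repr p ++ repr q).
Definition tensor_mul (a : R) (p : tensor) : tensor :=
  \pi_tensor (scale_terms a (repr p)).
Definition tensor_opp (p : tensor) : tensor := tensor_mul (-1) p.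

Lemma tensor_add_pi s t :
  tensor_add (\pi_tensor s) (\pi_tensor t) = \pi_tensor (s ++ t).
Proof. by apply/tensor_eqP/tensor_cat; apply: tensor_repr. Qed.

Lemma tensor_mul_pi a s :
  tensor_mul a (\pi_tensor s) = \pi_tensor (scale_terms a s).
Proof. by apply/tensor_eqP/scale_terms_rel/tensor_repr. Qed.

Lemma tensor_addA : associative tensor_add.
Proof.
move=> p q r; rewrite -[p]reprK -[q]reprK -[r]reprK.
rewrite (tensor_add_pi (repr p) (repr q)) (tensor_add_pi (repr q) (repr r)).
by rewrite !tensor_add_pi catA.
Qed.

Lemma tensor_addC : commutative tensor_add.
Proof. by move=> p q; apply/tensor_eqP/tensor_comm. Qed.

Lemma tensor_add0 : left_id tensor_zero tensor_add.
Proof. by move=> p; rewrite -[p]reprK tensor_add_pi. Qed.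

Lemma tensor_mulDl p :
  {morph tensor_mul^~ p : a b / a + b >-> tensor_add a b}.
Proof.
move=> a b; rewrite -[p]reprK !tensor_mul_pi tensor_add_pi; apply/tensor_eqP.
elim: (repr p) => [|[x y] s IH] /=; first exact: tensor_refl.
rewrite scalerDl; apply: tensor_trans (_ : tensor_rel
  ([:: (a *: x, y); (b *: x, y)] ++ (scale_terms a s ++ scale_terms b s)) _).
  by rewrite -cat1s; apply: tensor_cat => //; apply: tensor_addl.
rewrite /= -cat1s -[X in tensor_rel _ X]cat1s.
apply: tensor_cat; first exact: tensor_refl.
rewrite -cat1s -[_ :: scale_terms b s]cat1s !catA.
by apply: tensor_cat; [exact: tensor_comm | exact: tensor_refl].
Qed.

Lemma tensor_mul0 p : tensor_mul 0 p = tensor_zero.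
Proof.
rewrite -[p]reprK tensor_mul_pi; apply/tensor_eqP.
elim: (repr p) => [|[x y] s IH] /=; first exact: tensor_refl.
by rewrite scale0r -cat1s -[[::]]cats0; apply: tensor_cat => //; apply: tensor_0l.
Qed.

Lemma tensor_mul1 : left_id 1 tensor_mul.
Proof.
move=> p; rewrite -[p]reprK tensor_mul_pi /scale_terms; congr (\pi _).
by rewrite -[RHS]map_id; apply: eq_map => -[x y]; rewrite /= scale1r.
Qed.

Lemma tensor_addN : left_inverse tensor_zero tensor_opp tensor_add.
Proof.
by move=> p; rewrite -{2}[p]tensor_mul1 -tensor_mulDl addNr tensor_mul0.
Qed.

HB.instance Definition _ := GRing.isZmodule.Build tensor
  tensor_addA tensor_addC tensor_add0 tensor_addN.

Lemma tensor_mulA a b p : tensor_mul a (tensor_mul b p) = tensor_mul (a * b) p.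
Proof.
rewrite -[p]reprK (tensor_mul_pi b (repr p)) !tensor_mul_pi /scale_terms.
rewrite -map_comp; congr (\pi _).
by apply: eq_map => -[x y] /=; rewrite scalerA.
Qed.

Lemma tensor_mulDr : right_distributive tensor_mul +%R.
Proof.
move=> a p q; rewrite -[p]reprK -[q]reprK.
rewrite [in LHS]/+%R /= (tensor_add_pi (repr p) (repr q)) !tensor_mul_pi.
by rewrite [RHS]tensor_add_pi /scale_terms map_cat.
Qed.

HB.instance Definition _ := GRing.Zmodule_isLmodule.Build R tensor
  tensor_mulA tensor_mul1 tensor_mulDr tensor_mulDl.

Definition pure_tensor (x : M) (y : N) : tensor := \pi_tensor [:: (x, y)].

Definition bilinear_map (P : lmodType R) (b : M -> N -> P) : Prop :=
  (forall y, linear (b^~ y)) /\ (forall x, linear (b x)).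

Lemma tensor_add_piE s t :
  \pi_tensor s + \pi_tensor t = \pi_tensor (s ++ t).
Proof. exact: tensor_add_pi. Qed.

Lemma tensor_scale_piE a s :
  a *: \pi_tensor s = \pi_tensor (scale_terms a s).
Proof. exact: tensor_mul_pi. Qed.

Lemma pure_tensor_bilinear : bilinear_map pure_tensor.
Proof.
split=> [y a x x'|x a y y']; rewrite /pure_tensor tensor_scale_piE tensor_add_piE;
  apply/tensor_eqP => /=.
  exact: tensor_addl.
apply: tensor_trans (tensor_addr _ _ _) _; rewrite -cat1s -[X in tensor_rel _ X]cat1s.
by apply: tensor_cat; [apply/tensor_sym/tensor_scale | apply: tensor_refl].
Qed.

Lemma tensor_sumE (p : tensor) :
  p = \sum_(xy <- repr p) pure_tensor xy.1 xy.2.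
Proof.
rewrite -[LHS]reprK; elim: (repr p) => [|[x y] s IH]; first by rewrite big_nil.
by rewrite big_cons -IH tensor_add_piE.
Qed.

Section Lift.
Variables (P : lmodType R) (b : M -> N -> P).

(** Only meaningful for bilinear [b], where it does not depend on the choice
    of the representative of [p], see [tensor_lift_pi]. *)
Definition tensor_lift (p : tensor) : P := \sum_(xy <- repr p) b xy.1 xy.2.

Hypothesis b_bil : bilinear_map b.

Lemma tensor_lift_pi s : tensor_lift (\pi_tensor s) = \sum_(xy <- s) b xy.1 xy.2.
Proof.
rewrite /tensor_lift; move: (repr _) (tensor_repr s) => r; case: b_bil => bl br.
elim=> {r s} //.
- by move=> s t u _ -> _ ->.
- by move=> s s' t t' _ h1 _ h2; rewrite [LHS]big_cat [RHS]big_cat /= h1 h2.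
- by move=> s t; rewrite [LHS]big_cat [RHS]big_cat /= addrC.
- move=> x x' y; rewrite !big_cons !big_nil /= !addr0.
  by have := bl y 1 x x'; rewrite !scale1r.
- move=> x y y'; rewrite !big_cons !big_nil /= !addr0.
  by have := br x 1 y y'; rewrite !scale1r.
- move=> a x y; rewrite !big_seq1 /=.
  have b0 : b 0 y = 0 by have := bl y (-1) 0 0; rewrite scaler0 addr0 scaleN1r addNr.
  have b0' : b x 0 = 0 by have := br x (-1) 0 0; rewrite scaler0 addr0 scaleN1r addNr.
  have := bl y a x 0; have := br x a y 0.
  by rewrite !addr0 b0 b0' !addr0 => -> ->.
- move=> y; rewrite big_seq1 big_nil /=.
  by have := bl y (-1) 0 0; rewrite scaler0 addr0 scaleN1r addNr.
- move=> x; rewrite big_seq1 big_nil /=.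
  by have := br x (-1) 0 0; rewrite scaler0 addr0 scaleN1r addNr.
Qed.

Lemma tensor_lift_pure x y : tensor_lift (pure_tensor x y) = b x y.
Proof. by rewrite tensor_lift_pi big_seq1. Qed.

Lemma tensor_lift_linear : linear tensor_lift.
Proof.
move=> a p q; rewrite -[p]reprK -[q]reprK tensor_scale_piE tensor_add_piE.
rewrite !tensor_lift_pi big_cat /= /scale_terms big_map scaler_sumr.
congr (_ + _); apply: eq_bigr => -[x y] _ /=; case: b_bil => bl _.
have b0 : b 0 y = 0 by have := bl y (-1) 0 0; rewrite scaler0 addr0 scaleN1r addNr.
by have := bl y a x 0; rewrite addr0 b0 addr0.
Qed.

End Lift.

Lemma tensor_universal (P : lmodType R) (b : M -> N -> P) :
  bilinear_map b ->
  exists! g : tensor -> P, linear g /\ forall x y, g (pure_tensor x y) = b x y.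
Proof.
move=> b_bil; exists (tensor_lift b); split.
  by split; [exact: tensor_lift_linear | exact: tensor_lift_pure].
move=> g [glin gE]; apply: funext => p.
have g0 : g 0 = 0 by have := glin (-1) 0 0; rewrite scaler0 addr0 scaleN1r addNr.
have gD (u v : tensor) : g (u + v) = g u + g v by have := glin 1 u v; rewrite !scale1r.
rewrite [in RHS](tensor_sumE p) (big_morph g gD g0).
by apply: eq_bigr => -[x y] _; rewrite gE.
Qed.

End Tensor.

Section Modules.
Variable R : comPzRingType.
Implicit Types M F : lmodType R.

Definition tensor_map (A B F : lmodType R) (f : {linear A -> B}) :
    tensor A F -> tensor B F :=
  tensor_lift (fun x y => pure_tensor (f x) y).

Lemma tensor_map_pure (A B F : lmodType R) (f : {linear A -> B}) x y :
  @tensor_map A B F f (pure_tensor x y) = pure_tensor (f x) y.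
Proof.
have [bl br] := @pure_tensor_bilinear R B F.
by apply: tensor_lift_pure; split=> [u a v w|u]; rewrite ?linearP; [apply: bl|apply: br].
Qed.

Definition flat F : Prop :=
  forall (A B : lmodType R) (f : {linear A -> B}),
    injective f -> injective (@tensor_map A B F f).

Definition projective (P : lmodType R) : Prop :=
  forall (A B : lmodType R) (p : {linear A -> B}) (f : {linear P -> B}),
    (forall b, exists a, p a = b) ->
    exists g : {linear P -> A}, forall x, p (g x) = f x.

Definition exact_at (A B C : lmodType R)
    (f : {linear A -> B}) (g : {linear B -> C}) : Prop :=
  forall y, g y = 0 <-> exists x, f x = y.

Record projective_resolution F := ProjectiveResolution {
  res_obj : nat -> lmodType R;
  res_diff : forall n, {linear res_obj n.+1 -> res_obj n};
  res_aug : {linear res_obj 0 -> F};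
  res_projective : forall n, projective (res_obj n);
  res_aug_surj : forall y, exists x, res_aug x = y;
  res_exact0 : exact_at (res_diff 0) res_aug;
  res_exactS : forall n, exact_at (res_diff n.+1) (res_diff n) }.

(** Vanishing of the cohomology of [Hom(P, M)] in degree [1] for every
    projective resolution [P] of [F]; this does not depend on [P]. *)
Definition Ext1_vanishes F M : Prop :=
  forall (P : projective_resolution F) (f : {linear res_obj P 1 -> M}),
    (forall x, f (res_diff P 1 x) = 0) ->
    exists g : {linear res_obj P 0 -> M}, forall x, f x = g (res_diff P 0 x).

Definition flat_cotorsion M : Prop :=
  flat M /\ forall F, flat F -> Ext1_vanishes F M.

End Modules.

Record complex (R : comPzRingType) := Complex {
  obj :> int -> lmodType R;
  diff : forall i : int, {linear obj i -> obj (i + 1)};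
  diffK : forall i x, diff (i + 1) (diff i x) = 0 }.

Section Complexes.
Variable R : comPzRingType.
Implicit Types X Y Z : complex R.

Record chain_map X Y := ChainMap {
  cmap :> forall i : int, {linear X i -> Y i};
  cmapE : forall i x, cmap (i + 1) (diff X i x) = diff Y i (cmap i x) }.

Lemma id_cmapE X i x : (idfun : {linear X (i + 1) -> X (i + 1)}) (diff X i x) =
  diff X i ((idfun : {linear X i -> X i}) x).
Proof. by []. Qed.

Definition id_map X : chain_map X X := ChainMap (@id_cmapE X).

Lemma comp_cmapE X Y Z (g : chain_map Y Z) (f : chain_map X Y) i x :
  (g (i + 1) \o f (i + 1) : {linear _ -> _}) (diff X i x) =
  diff Z i ((g i \o f i : {linear _ -> _}) x).
Proof. by rewrite /= !cmapE. Qed.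

Definition comp_map X Y Z (g : chain_map Y Z) (f : chain_map X Y) :
  chain_map X Z := ChainMap (comp_cmapE g f).

Definition is_iso X Y (f : chain_map X Y) : Prop :=
  exists g : chain_map Y X,
    (forall i, cancel (f i) (g i)) /\ (forall i, cancel (g i) (f i)).

(** [f - g = d s + s d], stated in degree [i + 1], where [i : int] is
    arbitrary, so that all the composites are well typed without casts. *)
Definition homotopic X Y (f g : chain_map X Y) : Prop :=
  exists s : forall i : int, {linear X (i + 1) -> Y i},
    forall i x,
      f (i + 1) x - g (i + 1) x = diff Y i (s i x) + s (i + 1) (diff X (i + 1) x).

Definition homotopy_equivalence X Y (f : chain_map X Y) : Prop :=
  exists g : chain_map Y X,
    homotopic (comp_map g f) (id_map X) /\ homotopic (comp_map f g) (id_map Y).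

Definition minimal X : Prop :=
  forall f : chain_map X X, homotopy_equivalence f -> is_iso f.

Lemma zero_diffK (i : int) (x : 'rV[R]_0) :
  (\0 : {linear 'rV[R]_0 -> 'rV[R]_0}) ((\0 : {linear 'rV[R]_0 -> 'rV[R]_0}) x) = 0.
Proof. by []. Qed.

Definition zero_complex : complex R :=
  @Complex R (fun=> 'rV[R]_0) (fun=> \0) zero_diffK.

(** Isomorphisms in the homotopy category are the classes of homotopy
    equivalences. *)
Definition contractible X : Prop :=
  exists f : chain_map X zero_complex, homotopy_equivalence f.

Section DirectSum.
Variables X Y : complex R.

Definition sum_diff i (p : X i * Y i) : X (i + 1) * Y (i + 1) :=
  (diff X i p.1, diff Y i p.2).

Lemma sum_diff_linear i : linear (@sum_diff i).
Proof. by move=> a p q; rewrite /sum_diff /= !linearP. Qed.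

HB.instance Definition _ i := GRing.isLinear.Build R
  (X i * Y i)%type (X (i + 1)%R * Y (i + 1)%R)%type *:%R (@sum_diff i)
  (@sum_diff_linear i).

Lemma sum_diffK i (p : X i * Y i) : sum_diff (sum_diff p) = 0.
Proof. by rewrite /sum_diff /= !diffK. Qed.

Definition direct_sum : complex R :=
  @Complex R (fun i => (X i * Y i)%type) (fun i => @sum_diff i) sum_diffK.

End DirectSum.
End Complexes.

(* Main.v *)
(** Write [S_p(X)] for the classes in [X/pX] divisible by every [s] outside the
    prime [p].

    Limits.  Let [X] be flat cotorsion and [F] a proper filter on [I].  As [R] is
    noetherian, the quotient of [X^I] by the families that are [F]-almost
    everywhere constant is flat, so [Ext^1 = 0] provides a linear "limit"
    [X^I -> X] extending the evaluation of those families.  This replaces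
    algebraic compactness: a system of linear equations and congruences in [X]
    is solvable as soon as its finite subsystems are.

    Primes detect isomorphisms.  If [x] is not in [NX], choose [N] maximal and
    then [t] with [p = (N : t)] prime; this yields a nonzero class in [S_p(X)].
    Hence a map between flat modules that is injective on all [S_p] is pure, and
    a map from a flat cotorsion module to a flat one that is bijective on all
    [S_p] is bijective.

    Splitting one map.  Given [d : X -> Y], let [B_p] be a maximal family in
    [S_p(X)] whose image under [d] is independent.  Some [t : Y -> X] satisfies
    [t (d b) = b] modulo [pX] for all [p] and [b] in [B_p]; these [t] form a
    compact semigroup for [f * g = f d g], so one of them, [s], is idempotent:
    [s d s = s], and [d - d s d] vanishes on every [S_p].

    Splitting a complex.  With such an [s] in each degree and
    [s' = (1 - d s) s], the null-homotopic chain map [e = d s' + s' d] is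
    idempotent.  Its image is contractible, and on its kernel [d] vanishes on
    every [S_p], so there [1 + d h + h d] is bijective for every [h]. *)
Require Import Defs.
From HB Require Import structures.
From mathcomp Require Import all_boot all_order all_algebra.
From mathcomp Require Import boolp classical_sets functions filter.

Set Implicit Arguments.
Unset Strict Implicit.
Unset Printing Implicit Defensive.

Import GRing.Theory.
Local Open Scope classical_set_scope.
Local Open Scope ring_scope.

(** * Submodules, ideals and the equational criterion of flatness *)

Section Submodules.
Variables (R : comPzRingType) (M : lmodType R).

Definition submodule (S : set M) : Prop :=
  S 0 /\ forall a x y, S x -> S y -> S (a *: x + y).

Variable S : set M.
Hypothesis hS : submodule S.

Lemma submodule0 : S 0.
Proof. by case: hS. Qed.

Lemma submoduleD x y : S x -> S y -> S (x + y).
Proof. by case: hS => _ h hx hy; rewrite -[x]scale1r; apply: h. Qed.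

Lemma submoduleZ a x : S x -> S (a *: x).
Proof. by case: hS => h0 h hx; rewrite -[_ *: _]addr0; apply: h. Qed.

Lemma submoduleN x : S x -> S (- x).
Proof. by move=> hx; rewrite -scaleN1r; apply: submoduleZ. Qed.

Lemma submoduleB x y : S x -> S y -> S (x - y).
Proof. by move=> hx hy; apply: submoduleD => //; apply: submoduleN. Qed.

Lemma submodule_sum (T : finType) (P : pred T) (x : T -> M) :
  (forall i, P i -> S (x i)) -> S (\sum_(i | P i) x i).
Proof. by move=> h; apply: big_ind => //; [exact: submodule0|exact: submoduleD]. Qed.

Lemma submodule_trans x y : S (x - y) -> S y -> S x.
Proof. by move=> h hy; rewrite -(subrK y x); apply: submoduleD. Qed.

End Submodules.

Section IdealMul.
Variables (R : comPzRingType).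
Implicit Types (X Y : lmodType R) (I p : set R).

Definition imul X I : set X :=
  [set x | exists (T : finType) (a : T -> R) (w : T -> X),
    (forall i, I (a i)) /\ x = \sum_i a i *: w i].

(* [N X] inside [X^K], for a submodule [N] of [R^K]. *)
Definition vmul X (K : finType) (N : set (K -> R^o)) : set (K -> X) :=
  [set x | exists (T : finType) (n : T -> K -> R^o) (w : T -> X),
    (forall i, N (n i)) /\ forall k, x k = \sum_i n i k *: w i].

Arguments imul : clear implicits.
Arguments vmul : clear implicits.

Lemma imul_gen X I a x : I a -> imul X I (a *: x).
Proof.
move=> ha; exists unit, (fun=> a), (fun=> x); split=> //.
by rewrite (big_pred1 tt) // => -[].
Qed.

Lemma imul_submodule X I : is_ideal I -> submodule (imul X I).
Proof.
move=> hI; split.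
  exists void, (fun=> 0), (fun=> 0); split; first by case.
  by rewrite big_pred0 // => -[].
move=> b x y [T [a [w [ha ->]]]] [T' [a' [w' [ha' ->]]]].
exists (T + T')%type, (fun i => match i with inl i => b * a i | inr i => a' i end),
  (fun i => match i with inl i => w i | inr i => w' i end); split.
  case=> i //; have [h0 h] := hI; rewrite -[_ * _]addr0; exact: h.
by rewrite big_sumType /= scaler_sumr; congr (_ + _); apply: eq_bigr => i _; rewrite scalerA.
Qed.

Lemma imul_map X Y I (f : {linear X -> Y}) x : imul X I x -> imul Y I (f x).
Proof.
move=> [T [a [w [ha ->]]]]; exists T, a, (f \o w); split=> //.
by rewrite linear_sum; apply: eq_bigr => i _; rewrite linearZ.
Qed.

Section Vectors.
Variables (K : finType).
Implicit Types (N : set (K -> R^o)).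

Definition vscale X (v : K -> R^o) (x : X) : K -> X := fun k => v k *: x.

Lemma vscale_linearl X (x : X) : linear (fun v => vscale v x).
Proof.
move=> a u v; apply: funext => k.
change ((a * u k + v k) *: x = a *: (u k *: x) + v k *: x).
by rewrite scalerA -scalerDl. Qed.

Lemma vscaleBl X u v (x : X) : vscale (u - v) x = vscale u x - vscale v x.
Proof. by apply: funext => k; exact: scalerBl. Qed.

Lemma vscaleBr X v (x y : X) : vscale v (x - y) = vscale v x - vscale v y.
Proof. by apply: funext => k; exact: scalerBr. Qed.

Lemma vscale_linearr X v : linear (fun x : X => vscale v x).
Proof.
move=> a x y; apply: funext => k.
change (v k *: (a *: x + y) = a *: (v k *: x) + v k *: y).
by rewrite scalerDr !scalerA mulrC.
Qed.

Lemma vscaleA X a v (x : X) : vscale v (a *: x) = vscale (a *: v) x.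
Proof. by apply: funext => k; rewrite /vscale scalerA mulrC. Qed.

Lemma vmul_gen X N v x : N v -> vmul X K N (vscale v x).
Proof.
move=> ha; exists unit, (fun=> v), (fun=> x); split=> // k.
by rewrite (big_pred1 tt) // => -[].
Qed.

Lemma vmul_submodule X N : submodule N -> submodule (vmul X K N).
Proof.
move=> hN; split.
  exists void, (fun=> 0), (fun=> 0); split; first by case.
  by move=> k; rewrite big_pred0 // => -[].
move=> b x y [T [a [w [ha hx]]]] [T' [a' [w' [ha' hy]]]].
exists (T + T')%type, (fun i => match i with inl i => b *: a i | inr i => a' i end),
  (fun i => match i with inl i => w i | inr i => w' i end); split.
  by case=> i //; apply: submoduleZ.
move=> k; rewrite big_sumType /= [LHS]/= /GRing.add /= hy; congr (_ + _).
rewrite /GRing.scale /= hx scaler_sumr; apply: eq_bigr => i _.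
by rewrite scalerA.
Qed.

Lemma vmul_map X Y N (f : {linear X -> Y}) x : vmul X K N x -> vmul Y K N (f \o x).
Proof.
move=> [T [a [w [ha hx]]]]; exists T, a, (f \o w); split=> // k.
by rewrite /= hx linear_sum; apply: eq_bigr => i _; rewrite linearZ.
Qed.

Lemma vmul_mono X N N' x : N `<=` N' -> vmul X K N x -> vmul X K N' x.
Proof. by move=> h [T [a [w [ha hx]]]]; exists T, a, w; split=> // i; apply/h/ha. Qed.

Lemma vmul_imul X N I v x : submodule N -> (forall a, I a -> N (a *: v)) ->
  imul X I x -> vmul X K N (vscale v x).
Proof.
move=> hN h [T [a [w [ha ->]]]]; exists T, (fun i => a i *: v), w; split.
  by move=> i; apply: h.
move=> k; rewrite /vscale scaler_sumr; apply: eq_bigr => i _.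
by rewrite scalerA mulrC.
Qed.

End Vectors.

(** The equational criterion of flatness, for finitely many relations at once. *)
Definition vflat X : Prop :=
  forall (K T : finType) (n : T -> K -> R) (x : T -> X),
    (forall k, \sum_i n i k *: x i = 0) ->
    exists (L : finType) (a : T -> L -> R) (w : L -> X),
      (forall i, x i = \sum_l a i l *: w l) /\
      forall l k, \sum_i a i l * n i k = 0.

(** Moving the element of [N X] to the left turns the hypothesis into a relation between the [x s]
    and finitely many further elements. The equational criterion trivializes it, which writes
    [\sum_s a s l *: t s] as a combination of elements of [N]. *)
Lemma vflat_rel X (K S : finType) (N : set (K -> R^o)) (t : S -> K -> R^o)
    (x : S -> X) : vflat X -> submodule N ->
  vmul X K N (\sum_s vscale (t s) (x s)) ->
  exists (L : finType) (a : S -> L -> R) (w : L -> X),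
    (forall s, x s = \sum_l a s l *: w l) /\
    forall l, N (\sum_s a s l *: t s).
Proof.
move=> fX hN [T [n [u [hn hx]]]].
pose m (i : (S + T)%type) : K -> R :=
  match i with inl s => t s | inr i => fun k => - n i k end.
pose y (i : (S + T)%type) := match i with inl s => x s | inr i => u i end.
have [|L [a [w [ha hw]]]] := fX K _ m y.
  move=> k; rewrite big_sumType /=; have := hx k; rewrite fct_sumE => ->.
  by rewrite -big_split big1 //= => i _; rewrite scaleNr addrN.
exists L, (fun s => a (inl s)), w; split; first by move=> s; exact: (ha (inl s)).
move=> l; have -> : \sum_s a (inl s) l *: t s = \sum_i a (inr i) l *: n i.
  apply: funext => k; rewrite !fct_sumE; apply/eqP; rewrite -subr_eq0 -sumrN.
  rewrite -[X in _ == X](hw l k) big_sumType /=; apply/eqP; congr (_ + _).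
  by apply: eq_bigr => i _; rewrite mulrN.
by apply: submodule_sum => // i _; apply: submoduleZ.
Qed.

(** The nontrivial inclusion of the colon formula [(N X : t) = (N : t) X] for flat modules. *)
Lemma vflat_colon X (K : finType) (N : set (K -> R^o)) t x :
  vflat X -> submodule N -> vmul X K N (vscale t x) ->
  imul X [set a | N (a *: t)] x.
Proof.
move=> fX hN h.
have [|L [a [w [ha hw]]]] := @vflat_rel X K unit N (fun=> t) (fun=> x) fX hN.
  by rewrite (big_pred1 tt) // => -[].
exists L, (a tt), w; split=> // l; have := hw l.
by rewrite (big_pred1 tt) // => -[].
Qed.

Lemma vflat_colon2 X (K : finType) (N : set (K -> R^o)) t u x y :
  vflat X -> submodule N -> vmul X K N (vscale t x - vscale u y) ->
  exists (L : finType) (a b : L -> R) (w : L -> X),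
    x = \sum_l a l *: w l /\ forall l, N (a l *: t - b l *: u).
Proof.
move=> fX hN h.
have [|L [a [w [ha hw]]]] := @vflat_rel X K bool N
  (fun c => if c then t else - u) (fun c => if c then x else y) fX hN.
  rewrite big_bool /=; congr (vmul _ _ _ _): h; congr (_ + _).
  by apply: funext => k; rewrite /vscale /= scaleNr.
exists L, (a true), (a false), w; split; first exact: (ha true).
by move=> l; have := hw l; rewrite big_bool /= scalerN.
Qed.

(** So [X/pX] is torsion-free over [R/p]. The ideal is viewed as a submodule of [R^1], indexed by
    [unit], to make [vflat_rel] applicable. *)
Lemma imul_prime X p s x : vflat X -> is_prime_ideal p -> ~ p s ->
  imul X p (s *: x) -> imul X p x.
Proof.
move=> fX [hp _ hpp] ps [T [a [w [ha hx]]]].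
have [||L [b [v [hb hv]]]] := @vflat_rel X unit unit [set f | p (f tt)]
    (fun _ _ => s) (fun=> x) fX.
- by split=> [|c u v]; [case: hp|case: hp => _; apply].
- exists T, (fun i _ => a i), w; split=> // -[].
  by rewrite -hx fct_sumE (big_pred1 tt) // => -[].
exists L, (b tt), v; split=> // l; have := hv l.
by rewrite (big_pred1 tt) => [|[]] //= /hpp [].
Qed.

End IdealMul.
Arguments imul {R} X I.
Arguments vmul {R} X {K} N.

(** * Submodules and quotients as modules *)

Section Subobject.
Variables (R : comPzRingType) (M : lmodType R) (S : set M) (hS : submodule S).

Definition subm_pred of submodule S : {pred M} := [pred x | `[< S x >]].

Lemma subm_closed : submod_closed (subm_pred hS).
Proof.
split; first by apply/asboolP; case: hS.
by move=> a x y /asboolP hx /asboolP hy; apply/asboolP; case: hS => _; apply.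
Qed.

Definition subm := {x : M | subm_pred hS x}.
HB.instance Definition _ := SubChoice.copy subm {x : M | subm_pred hS x}.
HB.instance Definition _ :=
  @GRing.SubChoice_isSubLmodule.Build R M (subm_pred hS) subm subm_closed.

Definition subm_val : {linear subm -> M} := val.

Lemma subm_valP (x : subm) : S (subm_val x).
Proof. by have /asboolP := valP x. Qed.

Lemma subm_val_inj : injective subm_val.
Proof. exact: val_inj. Qed.

Definition subm_mk x (hx : S x) : subm := Sub x (asboolT hx).

Lemma subm_mkK x (hx : S x) : subm_val (subm_mk hx) = x.
Proof. exact: SubK. Qed.

End Subobject.
Arguments subm_val {R M S hS}.
Arguments subm_valP {R M S hS} x.
Arguments subm_val_inj {R M S hS}.

Section Quotient.
Local Open Scope quotient_scope.
Variables (R : comPzRingType) (M : lmodType R) (S : set M) (hS : submodule S).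

Definition quotm_rel of submodule S : rel M := fun x y => `[< S (x - y) >].

Lemma quotm_equiv : equiv_class_of (quotm_rel hS).
Proof.
split=> [x|x y|y x z].
- by apply/asboolP; rewrite subrr; apply: submodule0.
- by apply/asboolP/asboolP => h; rewrite -opprB; apply: submoduleN.
- move=> /asboolP h1 /asboolP h2; apply/asboolP.
  by rewrite -[x](subrK y) -addrA; apply: submoduleD.
Qed.

Canonical quotm_equivRel := EquivRelPack quotm_equiv.
Canonical quotm_encModRel := defaultEncModRel (quotm_rel hS).

Definition quotm := {eq_quot quotm_rel hS}.
HB.instance Definition _ : EqQuotient _ (quotm_rel hS) quotm := EqQuotient.on quotm.
HB.instance Definition _ := Choice.on quotm.

Lemma quotm_eq x y : (\pi_quotm x = \pi_quotm y) <-> S (x - y).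
Proof.
split=> [/eqP|h]; first by rewrite piE => /asboolP.
by apply/eqP; rewrite piE; apply/asboolP.
Qed.

Lemma quotm_repr x : S (repr (\pi_quotm x) - x).
Proof. by apply/quotm_eq; rewrite reprK. Qed.

Definition quotm_add (p q : quotm) : quotm := \pi_quotm (repr p + repr q).
Definition quotm_opp (p : quotm) : quotm := \pi_quotm (- repr p).
Definition quotm_scale (a : R) (p : quotm) : quotm := \pi_quotm (a *: repr p).

Lemma quotm_add_pi x y : quotm_add (\pi_quotm x) (\pi_quotm y) = \pi_quotm (x + y).
Proof.
by apply/quotm_eq; rewrite opprD addrACA; apply: submoduleD => //; apply: quotm_repr.
Qed.

Lemma quotm_opp_pi x : quotm_opp (\pi_quotm x) = \pi_quotm (- x).
Proof. by apply/quotm_eq; rewrite -opprD; apply: submoduleN => //; apply: quotm_repr. Qed.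

Lemma quotm_scale_pi a x : quotm_scale a (\pi_quotm x) = \pi_quotm (a *: x).
Proof. by apply/quotm_eq; rewrite -scalerBr; apply: submoduleZ => //; apply: quotm_repr. Qed.

Lemma quotm_ind (P : quotm -> Prop) : (forall x, P (\pi_quotm x)) -> forall q, P q.
Proof. by move=> h q; rewrite -[q]reprK. Qed.

Lemma quotm_addA : associative quotm_add.
Proof.
elim/quotm_ind=> x; elim/quotm_ind=> y; elim/quotm_ind=> z.
by rewrite !quotm_add_pi addrA.
Qed.

Lemma quotm_addC : commutative quotm_add.
Proof. by elim/quotm_ind=> x; elim/quotm_ind=> y; rewrite !quotm_add_pi addrC. Qed.

Lemma quotm_add0 : left_id (\pi_quotm 0) quotm_add.
Proof. by elim/quotm_ind=> x; rewrite quotm_add_pi add0r. Qed.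

Lemma quotm_addN : left_inverse (\pi_quotm 0) quotm_opp quotm_add.
Proof. by elim/quotm_ind=> x; rewrite quotm_opp_pi quotm_add_pi addNr. Qed.

HB.instance Definition _ := GRing.isZmodule.Build quotm
  quotm_addA quotm_addC quotm_add0 quotm_addN.

Lemma quotm_scaleA a b q : quotm_scale a (quotm_scale b q) = quotm_scale (a * b) q.
Proof. by elim/quotm_ind: q => x; rewrite !quotm_scale_pi scalerA. Qed.

Lemma quotm_scale1 : left_id 1 quotm_scale.
Proof. by elim/quotm_ind=> x; rewrite quotm_scale_pi scale1r. Qed.

Lemma quotm_scaleDr : right_distributive quotm_scale +%R.
Proof.
move=> a; elim/quotm_ind=> x; elim/quotm_ind=> y.
rewrite -[X in quotm_scale a X]/(quotm_add _ _) -[RHS]/(quotm_add _ _).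
by rewrite !(quotm_add_pi, quotm_scale_pi) scalerDr.
Qed.

Lemma quotm_scaleDl q : {morph quotm_scale^~ q : a b / a + b}.
Proof.
move=> a b; elim/quotm_ind: q => x.
by rewrite -[RHS]/(quotm_add _ _) !quotm_scale_pi quotm_add_pi scalerDl.
Qed.

HB.instance Definition _ := GRing.Zmodule_isLmodule.Build R quotm
  quotm_scaleA quotm_scale1 quotm_scaleDr quotm_scaleDl.

Definition quotm_proj (x : M) : quotm := \pi_quotm x.

Lemma quotm_proj_linear : linear quotm_proj.
Proof.
move=> a x y; rewrite /quotm_proj -[RHS]/(quotm_add (quotm_scale a _) _).
by rewrite quotm_scale_pi quotm_add_pi.
Qed.

HB.instance Definition _ :=
  GRing.isLinear.Build R M quotm *:%R quotm_proj quotm_proj_linear.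

Lemma quotm_proj_surj (q : quotm) : exists x, quotm_proj x = q.
Proof. by exists (repr q); rewrite /quotm_proj reprK. Qed.

Lemma quotm_proj_eq0 x : quotm_proj x = 0 <-> S x.
Proof. by rewrite -[0]/(\pi_quotm 0) quotm_eq subr0. Qed.

End Quotient.
Arguments quotm_proj {R M S} hS.

(** * From tensor flatness to the equational criterion *)

Section Flatness.
Variable R : comPzRingType.
Implicit Types X F : lmodType R.

Lemma linear_comb (U V : lmodType R) (f : U -> V) (T : finType) (a : T -> R) (x : T -> U) :
  linear f -> f (\sum_i a i *: x i) = \sum_i a i *: f (x i).
Proof.
move=> hf; have f0 : f 0 = 0 by have := hf (-1) 0 0; rewrite scaler0 addr0 scaleN1r addNr.
have fD (u v : U) : f (u + v) = f u + f v by have := hf 1 u v; rewrite !scale1r.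
rewrite (big_morph f fD f0); apply: eq_bigr => i _.
by have := hf (a i) (x i) 0; rewrite !addr0 f0 addr0.
Qed.

Lemma linear_bigsum (U V : lmodType R) (f : U -> V) (T : finType) (x : T -> U) :
  linear f -> f (\sum_i x i) = \sum_i f (x i).
Proof.
move=> hf; have := linear_comb (fun=> 1) x hf.
under eq_bigr do rewrite scale1r.
by under [in X in _ = X -> _]eq_bigr do rewrite scale1r.
Qed.

Lemma tensor_map_linear (A B F : lmodType R) (f : {linear A -> B}) :
  linear (@tensor_map R A B F f).
Proof.
have [bl br] := @pure_tensor_bilinear R B F.
by apply: tensor_lift_linear; split=> [u a v w|u]; rewrite ?linearP; [apply: bl|apply: br].
Qed.

Lemma tensor_map0 (A B F : lmodType R) (f : {linear A -> B}) :
  @tensor_map R A B F f 0 = 0.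
Proof.
by have := tensor_map_linear f (-1) (0 : tensor A F) 0; rewrite scaler0 addr0 scaleN1r addNr.
Qed.

Lemma pure_tensor_sum0 (B X : lmodType R) (T K : finType) (b : K -> B) (x : T -> X)
    (c : T -> K -> R) : (forall k, \sum_i c i k *: x i = 0) ->
  \sum_i pure_tensor (\sum_k c i k *: b k) (x i) = 0.
Proof.
move=> h; have [bl br] := @pure_tensor_bilinear R B X.
transitivity (\sum_i \sum_k c i k *: pure_tensor (b k) (x i)).
  by apply: eq_bigr => i _; rewrite (linear_comb _ _ (bl (x i))).
rewrite exchange_big big1 //= => k _.
rewrite -(linear_comb _ _ (br (b k))) h.
by have := br (b k) (-1) 0 0; rewrite scaler0 addr0 scaleN1r addNr.
Qed.

Definition basis_vec (K : finType) (k : K) : K -> R^o := fun j => (j == k)%:R.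

Lemma vec_basis (K : finType) (v : K -> R^o) : v = \sum_k v k *: basis_vec k.
Proof.
apply: funext => j; rewrite fct_sumE (bigD1 j) //= big1 => [|k kj].
  by rewrite /basis_vec scalrfctE eqxx addr0 [RHS]mulr1.
by rewrite /basis_vec scalrfctE eq_sym (negPf kj) [LHS]mulr0.
Qed.

Lemma vscale_basis X (K : finType) (x : K -> X) : \sum_k vscale (basis_vec k) (x k) = x.
Proof.
apply: funext => j; rewrite fct_sumE (bigD1 j) //= big1 => [|k kj].
  by rewrite /vscale /basis_vec eqxx scale1r addr0.
by rewrite /vscale /basis_vec eq_sym (negPf kj) scale0r.
Qed.

(** Let [S] be the span of the [n i] in [R^K] and [N] their module of relations, so that [S] is
    [R^T/N]. The sum of the tensors of [n i] with [x i] vanishes over [R^K], hence by flatness over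
    [S]; its image in [X^T/NX] is the class of [x], so [x] lies in [N X]. *)
Lemma flat_vflat X : flat X -> vflat X.
Proof.
move=> fX K T n x hx.
pose B : lmodType R := K -> R^o.
pose nn : T -> B := n.
pose S : set B := [set v | exists c : T -> R, v = \sum_i c i *: nn i].
have hS : submodule S.
  split; first by exists (fun=> 0); rewrite big1 // => i _; rewrite scale0r.
  move=> a u v [c ->] [c' ->]; exists (fun i => a * c i + c' i).
  rewrite scaler_sumr -big_split; apply: eq_bigr => i _ /=.
  by rewrite scalerDl scalerA.
pose N : set (T -> R^o) := [set c | \sum_i c i *: nn i = 0].
have hN : submodule N.
  split; first by rewrite /N /= big1 // => i _; rewrite scale0r.
  move=> a u v; rewrite /N /= => hu hv.
  transitivity (a *: (\sum_i u i *: nn i) + \sum_i v i *: nn i); last first.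
    by rewrite hu hv scaler0 addr0.
  rewrite scaler_sumr -big_split; apply: eq_bigr => i _ /=.
  by rewrite scalerDl scalerA.
have hNX := @vmul_submodule R T X N hN.
have hn i : S (nn i).
  exists (basis_vec i); rewrite (bigD1 i) //= big1 => [|j ji].
    by rewrite /basis_vec eqxx scale1r addr0.
  by rewrite /basis_vec (negPf ji) scale0r.
(* The coefficients are determined only modulo [N], so [b] becomes bilinear in the quotient by
   [N X]. *)
have /choice [c hc] (v : subm hS) : exists c : T -> R^o, subm_val v = \sum_i c i *: nn i.
  by have [c hc] := subm_valP v; exists c.
pose b (v : subm hS) y := quotm_proj hNX (vscale (c v) y).
have b_bil : bilinear_map b.
  split=> [y a u v|v a y z]; rewrite /b -linearP; apply/eqP; rewrite -subr_eq0 -linearB.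
    apply/eqP/quotm_proj_eq0.
    have -> : vscale (c (a *: u + v)) y - (a *: vscale (c u) y + vscale (c v) y) =
      vscale (c (a *: u + v) - (a *: c u + c v)) y.
      by rewrite vscaleBl -vscale_linearl.
    apply: vmul_gen; rewrite /N /=.
    transitivity (\sum_i c (a *: u + v) i *: nn i -
        (a *: (\sum_i c u i *: nn i) + \sum_i c v i *: nn i)).
      rewrite scaler_sumr -big_split -sumrB; apply: eq_bigr => i _ /=.
      by rewrite scalerA -scalerDl -scalerBl.
    by rewrite -!hc linearP subrr.
  apply/eqP/quotm_proj_eq0.
  rewrite vscale_linearr subrr.
  exact: submodule0.
pose t : tensor (subm hS) X := \sum_i pure_tensor (subm_mk hS (hn i)) (x i).
have linb := tensor_lift_linear b_bil.
have [bl br] := @pure_tensor_bilinear R B X.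
have t0 : t = 0.
  apply: (fX _ _ (@subm_val R _ S hS) subm_val_inj).
  rewrite tensor_map0.
  rewrite (linear_bigsum _ (@tensor_map_linear _ _ X _)).
  rewrite -[RHS](pure_tensor_sum0 (fun k => basis_vec k : B) hx).
  under eq_bigr do rewrite tensor_map_pure subm_mkK.
  by under [RHS]eq_bigr do rewrite -vec_basis.
have : quotm_proj hNX (\sum_i vscale (c (subm_mk hS (hn i))) (x i)) = 0.
  have := linear_bigsum (fun i => pure_tensor (subm_mk hS (hn i)) (x i)) linb.
  rewrite -/t t0; have := linb (-1) 0 0; rewrite scaler0 addr0 scaleN1r addNr => -> h.
  by rewrite linear_sum [RHS]h; apply: eq_bigr => i _; rewrite tensor_lift_pure.
move/quotm_proj_eq0 => h.
have : vmul X N x.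
  rewrite -[x in vmul _ _ x]vscale_basis; apply: submodule_trans h => //.
  rewrite -sumrB; apply: submodule_sum => // i _.
  have -> : vscale (basis_vec i) (x i) - vscale (c (subm_mk hS (hn i))) (x i) =
    vscale (basis_vec i - c (subm_mk hS (hn i))) (x i).
    by rewrite vscaleBl.
  apply: vmul_gen; rewrite /N /=.
  transitivity (\sum_j basis_vec i j *: nn j - \sum_j c (subm_mk hS (hn i)) j *: nn j).
    by rewrite -sumrB; apply: eq_bigr => j _; rewrite -scalerBl.
  rewrite -hc subm_mkK (bigD1 i) //= big1 => [|j ji].
    by rewrite /basis_vec eqxx scale1r addr0 subrr.
  by rewrite /basis_vec (negPf ji) scale0r.
move=> [L [m [w [hm hw]]]]; exists L, (fun i l => m l i), w; split=> // l k.
by have := congr1 (@^~ k) (hm l); rewrite fct_sumE.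
Qed.

End Flatness.

(** * From the equational criterion to tensor flatness *)

Section FlatOfEquational.
Variables (R : comPzRingType) (F : lmodType R).
Hypothesis fF : vflat F.
Implicit Types (B : lmodType R) (L M : finType).

Definition comb L (w : L -> F) (c : L -> R) : F := \sum_l c l *: w l.

Definition expand B L (w : L -> F) (u : seq (B * (L -> R))) : seq (B * F) :=
  [seq (p.1, comb w p.2) | p <- u].

Definition coefs B L (u : seq (B * (L -> R))) (l : L) : B :=
  \sum_(p <- u) p.2 l *: p.1.

(* Over a flat module, two formal sums of pure tensors are congruent iff, once
   their right components are written in terms of finitely many common elements
   [w], the coefficients of each [w l] agree. *)
Definition same_coefs B (s t : seq (B * F)) : Prop :=
  exists L (w : L -> F) u v,
    [/\ s = expand w u, t = expand w v & forall l, coefs u l = coefs v l].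

Definition subst L M (A : L -> M -> R) (c : L -> R) : M -> R :=
  fun m => \sum_l c l * A l m.

Definition substs B L M (A : L -> M -> R) (u : seq (B * (L -> R))) :=
  [seq (p.1, subst A p.2) | p <- u].

Lemma comb_subst L M (w : L -> F) (A : L -> M -> R) z c :
  (forall l, w l = comb z (A l)) -> comb w c = comb z (subst A c).
Proof.
move=> h; rewrite /comb /subst; under eq_bigr do rewrite h scaler_sumr.
rewrite exchange_big /=; apply: eq_bigr => m _; rewrite scaler_suml.
by apply: eq_bigr => l _; rewrite scalerA.
Qed.

Lemma expand_subst B L M (w : L -> F) (A : L -> M -> R) z (u : seq (B * (L -> R))) :
  (forall l, w l = comb z (A l)) -> expand w u = expand z (substs A u).
Proof.
move=> h; rewrite /expand /substs -map_comp; apply: eq_map => p /=.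
by rewrite (comb_subst _ h).
Qed.

Lemma coefs_subst B L M (A : L -> M -> R) (u : seq (B * (L -> R))) m :
  coefs (substs A u) m = \sum_l A l m *: coefs u l.
Proof.
rewrite /coefs /substs big_map /=; under [RHS]eq_bigr do rewrite scaler_sumr.
rewrite exchange_big /=; apply: eq_bigr => p _; rewrite /subst scaler_suml.
by apply: eq_bigr => l _; rewrite scalerA mulrC.
Qed.

Lemma coefs_cat B L (u v : seq (B * (L -> R))) l :
  coefs (u ++ v) l = coefs u l + coefs v l.
Proof. exact: big_cat. Qed.

Lemma expand_cat B L (w : L -> F) (u v : seq (B * (L -> R))) :
  expand w (u ++ v) = expand w u ++ expand w v.
Proof. exact: map_cat. Qed.

(** Comparing the two expansions term by term gives relations between the [w] and the [w']. The
    equational criterion rewrites all of them over common elements [z] for which these relations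
    hold coefficientwise. *)
Lemma common_subst B L L' (w : L -> F) (w' : L' -> F) u (v : seq (B * (L' -> R))) :
  expand w u = expand w' v ->
  exists M (z : M -> F) (A : L -> M -> R) (A' : L' -> M -> R),
    [/\ forall l, w l = comb z (A l), forall l, w' l = comb z (A' l) &
      forall m, coefs (substs A u) m = coefs (substs A' v) m].
Proof.
move=> h; have sz : size u = size v by have := congr1 size h; rewrite !size_map.
pose d : B * (L -> R) := (0, fun=> 0); pose d' : B * (L' -> R) := (0, fun=> 0).
pose n (i : (L + L')%type) (k : 'I_(size u)) : R :=
  match i with inl l => (nth d u k).2 l | inr l => - (nth d' v k).2 l end.
pose y (i : (L + L')%type) := match i with inl l => w l | inr l => w' l end.
have hk (k : 'I_(size u)) : (nth d u k).1 = (nth d' v k).1 /\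
    comb w (nth d u k).2 = comb w' (nth d' v k).2.
  have := congr1 (fun s => nth (0, 0) s k) h.
  by rewrite /expand (nth_map d) // (nth_map d') -?sz // => -[].
have [|M [a [z [ha hz]]]] := fF (n := n) (x := y).
  move=> k; rewrite big_sumType /= -/(comb _ _) (hk k).2 /comb -big_split /=.
  by rewrite big1 // => l _; rewrite scaleNr addrN.
exists M, z, (fun l => a (inl l)), (fun l => a (inr l)); split.
- by move=> l; exact: (ha (inl l)).
- by move=> l; exact: (ha (inr l)).
- move=> m; rewrite /coefs /substs !big_map /= (big_nth d) (big_nth d') !big_mkord -sz.
  apply: eq_bigr => k _; rewrite (hk k).1; congr (_ *: _); apply/eqP.
  have := hz m k; rewrite big_sumType /= => e; rewrite -subr_eq0 -sumrN; apply/eqP.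
  rewrite -{}[RHS]e /subst; congr (_ + _); apply: eq_bigr => l _; first exact: mulrC.
  by rewrite mulrN mulrC.
Qed.

Lemma same_coefs_trans B (s t r : seq (B * F)) :
  same_coefs s t -> same_coefs t r -> same_coefs s r.
Proof.
move=> [L [w [u [v [-> -> e]]]]] [L' [w' [u' [v' [h -> e']]]]].
have [M [z [A [A' [hA hA' hm]]]]] := common_subst h.
exists M, z, (substs A u), (substs A' v'); split; try exact: expand_subst.
move=> m; transitivity (coefs (substs A v) m).
  by rewrite !coefs_subst; apply: eq_bigr => l _; rewrite e.
by rewrite hm !coefs_subst; apply: eq_bigr => l _; rewrite e'.
Qed.

Lemma same_coefs_cat B (s s' t t' : seq (B * F)) :
  same_coefs s s' -> same_coefs t t' -> same_coefs (s ++ t) (s' ++ t').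
Proof.
move=> [L [w [u [v [-> -> e]]]]] [L' [w' [u' [v' [-> -> e']]]]].
pose z (i : (L + L')%type) := match i with inl l => w l | inr l => w' l end.
pose A (l : L) (i : (L + L')%type) : R := (i == inl l)%:R.
pose A' (l : L') (i : (L + L')%type) : R := (i == inr l)%:R.
have hA l : w l = comb z (A l).
  rewrite /comb (bigD1 (inl l)) //= big1 => [|i il]; first by rewrite /A eqxx scale1r addr0.
  by rewrite /A (negPf il) scale0r.
have hA' l : w' l = comb z (A' l).
  rewrite /comb (bigD1 (inr l)) //= big1 => [|i il]; first by rewrite /A' eqxx scale1r addr0.
  by rewrite /A' (negPf il) scale0r.
exists _, z, (substs A u ++ substs A' u'), (substs A v ++ substs A' v'); split.
- by rewrite expand_cat -(expand_subst _ hA) -(expand_subst _ hA').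
- by rewrite expand_cat -(expand_subst _ hA) -(expand_subst _ hA').
- move=> i; rewrite !coefs_cat !coefs_subst.
  by congr (_ + _); apply: eq_bigr => l _; rewrite ?e ?e'.
Qed.

Lemma same_coefs1 B (x : B) (y : F) : same_coefs [:: (x, y)] [:: (x, y)].
Proof.
exists unit, (fun=> y), [:: (x, fun=> 1)], [:: (x, fun=> 1)].
by split=> //; rewrite /expand /comb /= (big_pred1 tt) ?scale1r // => -[].
Qed.

Lemma same_coefs_refl B (s : seq (B * F)) : same_coefs s s.
Proof.
elim: s => [|[x y] s IH]; first by exists void, (fun=> 0), [::], [::].
rewrite -cat1s; apply: same_coefs_cat => //; exact: same_coefs1.
Qed.

Lemma same_coefs_comm B (s t : seq (B * F)) : same_coefs (s ++ t) (t ++ s).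
Proof.
have [L [w [u [v [hu hv e]]]]] := same_coefs_refl (s ++ t).
exists L, w, u, (drop (size s) u ++ take (size s) u); split=> //.
  have := congr1 (fun r => drop (size s) r ++ take (size s) r) hu.
  by rewrite drop_size_cat // take_size_cat // /expand -map_drop -map_take -map_cat.
move=> l; rewrite -{1}[u](cat_take_drop (size s)) !coefs_cat; exact: addrC.
Qed.

(** Induction on the congruence. Flatness enters through transitivity; the generating relations have
    explicit expansions. *)
Lemma tensor_rel_same_coefs B (s t : seq (B * F)) : tensor_rel s t -> same_coefs s t.
Proof.
elim=> {s t}.
- exact: same_coefs_refl.
- move=> s t _ [L [w [u [v [-> -> e]]]]]; by exists L, w, v, u; split.
- by move=> s t r _ h1 _ h2; apply: same_coefs_trans h1 h2.
- by move=> s s' t t' _ h1 _ h2; apply: same_coefs_cat.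
- exact: same_coefs_comm.
- move=> x x' y; exists unit, (fun=> y), [:: (x + x', fun=> 1)],
    [:: (x, fun=> 1); (x', fun=> 1)].
  by split=> [||l]; rewrite /expand /comb /coefs /= ?(big_pred1 tt) ?scale1r ?big_cons
    ?big_nil //= ?scale1r ?addr0 // => -[].
- move=> x y y'; exists bool, (fun b => if b then y else y'), [:: (x, fun=> 1)],
    [:: (x, fun b : bool => b%:R); (x, fun b : bool => (~~ b)%:R)].
  split=> [||l]; rewrite /expand /comb /coefs /= ?big_bool /= ?scale1r ?scale0r ?addr0 ?add0r //.
  by rewrite !big_cons !big_nil /=; case: l; rewrite ?scale1r ?scale0r ?addr0 ?add0r.
- move=> a x y; exists unit, (fun=> y), [:: (a *: x, fun=> 1)], [:: (x, fun=> a)].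
  by split=> [||l]; rewrite /expand /comb /coefs /= ?(big_pred1 tt) ?scale1r ?big_seq1
    //= ?scale1r // => -[].
- move=> y; exists unit, (fun=> y), [:: (0, fun=> 1)], [::].
  by split=> [||l]; rewrite /expand /comb /coefs /= ?(big_pred1 tt) ?scale1r ?big_seq1
    ?big_nil //= ?scaler0 // => -[].
- move=> x; exists unit, (fun=> 0), [:: (x, fun=> 0)], [::].
  by split=> [||l]; rewrite /expand /comb /coefs /= ?(big_pred1 tt) ?scaler0 ?big_seq1
    ?big_nil //= ?scale0r // => -[].
Qed.

(** If [f] kills a formal sum, then over suitable [w] its coefficients are sent to zero by [f].
    Injectivity makes them zero already in [A]. *)
Lemma vflat_flat : flat F.
Proof.
move=> A B f finj.
suff ker0 p : @tensor_map R A B F f p = 0 -> p = 0.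
  move=> p q e; apply/eqP; rewrite -subr_eq0; apply/eqP/ker0.
  have := tensor_map_linear f (-1) q p; rewrite e !scaleN1r addNr => <-.
  by congr tensor_map; rewrite addrC.
rewrite {1}(tensor_sumE p) -{2}[p]reprK; move: (repr p) => s {p} h.
have {h} : tensor_rel [seq (f q.1, q.2) | q <- s] [::].
  apply/tensor_eqP; rewrite -[RHS]h {h}; elim: s => [|[x y] s IH] /=.
    by rewrite big_nil tensor_map0.
  have := tensor_map_linear f 1 (pure_tensor x y) (\sum_(q <- s) pure_tensor q.1 q.2).
  by rewrite big_cons !scale1r => ->; rewrite -IH tensor_map_pure tensor_add_piE.
move/tensor_rel_same_coefs => [L [w [u [v [hu hv e]]]]].
have v0 : v = [::] by case: v hv {e}.
have {v v0 hv} e l : coefs u l = 0 by rewrite e v0 /coefs big_nil.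
have [u' [hu' hs]] : exists u', u = [seq (f q.1, q.2) | q <- u'] /\ s = expand w u'.
  elim: s u hu {e} => [|[x y] s IH] [|[b c] u] //=; first by exists [::].
  case=> <- -> /IH[u' [-> ->]].
  by exists ((x, c) :: u').
have e' l : coefs u' l = 0.
  apply: finj; rewrite linear0 -[RHS](e l) hu' /coefs big_map linear_sum.
  by apply: eq_bigr => q _; rewrite linearZ.
have [bl br] := @pure_tensor_bilinear R A F.
rewrite hs; transitivity (\sum_(q <- u') pure_tensor q.1 (comb w q.2)).
  elim: u' {hu' hs e'} => [|[x y] s' IH]; first by rewrite big_nil.
  by rewrite big_cons -IH tensor_add_piE.
transitivity (\sum_l pure_tensor (coefs u' l) (w l)); last first.
  rewrite big1 // => l _; rewrite e'.
  by have := bl (w l) (-1) 0 0; rewrite scaler0 addr0 scaleN1r addNr.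
transitivity (\sum_l \sum_(q <- u') q.2 l *: pure_tensor q.1 (w l)).
  rewrite exchange_big; apply: eq_bigr => q _; exact: (linear_comb _ _ (br q.1)).
apply: eq_bigr => l _; rewrite /coefs.
elim: u' {hu' hs e'} => [|q s' IH].
  by rewrite !big_nil; have := bl (w l) (-1) 0 0; rewrite scaler0 addr0 scaleN1r addNr.
by rewrite !big_cons IH; have := bl (w l) (q.2 l) q.1 => ->.
Qed.

End FlatOfEquational.

(** * Extending linear maps along submodules with flat quotient *)

Section LinearOf.
Variables (R : comPzRingType) (U V : lmodType R).

Definition lin_fun (f : U -> V) of linear f := f.
HB.instance Definition _ f (hf : linear f) :=
  GRing.isLinear.Build R U V *:%R (lin_fun hf) hf.

Definition linear_of f (hf : linear f) : {linear U -> V} := lin_fun hf.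

End LinearOf.

(** * Free modules, as functions of finite support *)

Section FreeModule.
Variables (R : comPzRingType) (T : choiceType).

Definition ev (M : lmodType R) (phi : T -> M) (s : seq (R * T)) : M :=
  \sum_(p <- s) p.1 *: phi p.2.

Definition dirac (t : T) : T -> R^o := fun x => (x == t)%:R.

Definition scales a (s : seq (R * T)) := [seq (a * p.1, p.2) | p <- s].

Lemma ev_cat (M : lmodType R) (phi : T -> M) s t :
  ev phi (s ++ t) = ev phi s + ev phi t.
Proof. exact: big_cat. Qed.

Lemma ev_scales (M : lmodType R) (phi : T -> M) a s :
  ev phi (scales a s) = a *: ev phi s.
Proof.
by rewrite /ev big_map scaler_sumr; apply: eq_bigr => p _; rewrite scalerA.
Qed.

Lemma ev_map (M N : lmodType R) (f : {linear M -> N}) phi s :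
  f (ev phi s) = ev (f \o phi) s.
Proof. by rewrite /ev linear_sum; apply: eq_bigr => p _; rewrite linearZ. Qed.

(** Collecting the terms of [s] by index, the coefficient of [phi t] is the value of [ev dirac s] at
    [t]. This makes [free_lift] independent of the chosen [free_seq]. *)
Lemma ev0 (M : lmodType R) (phi : T -> M) s : ev dirac s = 0 -> ev phi s = 0.
Proof.
move=> h; pose U := undup [seq p.2 | p <- s].
transitivity (\sum_(p <- s) \sum_(t <- U) (p.1 * dirac p.2 t) *: phi t).
  apply: eq_big_seq => p ps; rewrite (bigD1_seq p.2) ?undup_uniq //=; last first.
    by rewrite mem_undup map_f.
  rewrite /dirac eqxx mulr1 big1 ?addr0 // => t /negPf tp.
  by rewrite tp mulr0 scale0r.
rewrite exchange_big big1 //= => t _; rewrite -scaler_suml.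
by have := congr1 (@^~ t) h; rewrite /ev fct_sumE => ->; rewrite scale0r.
Qed.

Definition finsupp : set (T -> R^o) := [set f | exists s, f = ev dirac s].

Lemma finsupp_submodule : submodule finsupp.
Proof.
split; first by exists [::]; rewrite /ev big_nil.
by move=> a _ _ [s ->] [t ->]; exists (scales a s ++ t); rewrite ev_cat ev_scales.
Qed.

Definition free : lmodType R := subm finsupp_submodule.

Definition free_seq (x : free) : seq (R * T) := projT1 (cid (subm_valP x)).

Lemma free_seqE x : subm_val x = ev dirac (free_seq x).
Proof. exact: (projT2 (cid (subm_valP x))). Qed.

Definition free_lift_fun (M : lmodType R) (phi : T -> M) (x : free) : M :=
  ev phi (free_seq x).

Lemma free_lift_seq (M : lmodType R) (phi : T -> M) x s :
  subm_val x = ev dirac s -> free_lift_fun phi x = ev phi s.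
Proof.
rewrite free_seqE => h; apply/eqP; rewrite -subr_eq0 -scaleN1r -ev_scales -ev_cat.
by apply/eqP/ev0; rewrite ev_cat ev_scales h scaleN1r subrr.
Qed.

Lemma free_lift_linear (M : lmodType R) (phi : T -> M) : linear (free_lift_fun phi).
Proof.
move=> a x y; rewrite -[in RHS]ev_scales -ev_cat; apply: free_lift_seq.
by rewrite linearP /= ev_cat ev_scales -!free_seqE.
Qed.

Definition free_lift (M : lmodType R) (phi : T -> M) : {linear free -> M} :=
  linear_of (free_lift_linear phi).

Lemma dirac_finsupp t : finsupp (dirac t).
Proof. by exists [:: (1, t)]; rewrite /ev big_seq1 scale1r. Qed.

Definition gen t : free := subm_mk finsupp_submodule (dirac_finsupp t).

Lemma free_lift_gen (M : lmodType R) (phi : T -> M) t : free_lift phi (gen t) = phi t.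
Proof.
rewrite -[LHS]/(free_lift_fun phi (gen t)) (@free_lift_seq _ _ _ [:: (1, t)]).
  by rewrite /ev big_seq1 scale1r.
by rewrite subm_mkK /ev big_seq1 scale1r.
Qed.

Lemma free_genE (x : free) : x = ev gen (free_seq x).
Proof.
apply: subm_val_inj; rewrite {1}free_seqE ev_map /ev; apply: eq_bigr => p _.
by rewrite -[RHS]/(_ *: subm_val (gen p.2)) subm_mkK.
Qed.

Lemma free_projective : projective free.
Proof.
move=> A B p f /(_ (f (gen _))) hp.
have /choice [phi hphi] t : exists a, p a = f (gen t) by exact: hp.
exists (free_lift phi) => x; rewrite [x]free_genE !ev_map.
by rewrite /ev; apply: eq_bigr => q _; rewrite /= free_lift_gen hphi.
Qed.

End FreeModule.

(** * Resolutions and extension of linear maps *)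

Section FreeResolution.
Variables (R : comPzRingType).

(* Killing the generators outside [ker d] avoids forming [ker d] as a module. *)
Definition ker_cover (A B : lmodType R) (d : {linear A -> B}) : {linear free R A -> A} :=
  free_lift (fun x => if `[< d x = 0 >] then x else 0).

Lemma ker_cover_exact (A B : lmodType R) (d : {linear A -> B}) :
  exact_at (ker_cover d) d.
Proof.
move=> y; split=> [h|[x <-]].
  by exists (gen R y); rewrite free_lift_gen asboolT.
rewrite [x]free_genE !ev_map /ev big1 // => p _ /=.
by rewrite free_lift_gen; case: asboolP => h; rewrite ?h ?linear0 ?scaler0.
Qed.

(** Source and target are bundled with the map, so that one recursion builds both modules and
    differentials of a resolution. *)
Definition arrow := {A : lmodType R & {B : lmodType R & {linear A -> B}}}.

Fixpoint res_arrow (a : arrow) (n : nat) : arrow :=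
  if n is m.+1 then
    let b := res_arrow a m in
    existT _ (free R (projT1 b)) (existT _ (projT1 b) (ker_cover (projT2 (projT2 b))))
  else a.

(** Kernels are covered by free modules repeatedly, starting from [q]. The module in degree 0 is [P]
    itself; [i] and [j] record this without an equality of types. *)
Lemma free_resolution (P Q : lmodType R) (q : {linear P -> Q}) :
  projective P -> (forall y, exists x, q x = y) ->
  exists r : projective_resolution Q,
    exists (i : {linear res_obj r 0 -> P}) (j : P -> res_obj r 0),
    [/\ forall x, res_aug r x = q (i x), cancel i j & cancel j i].
Proof.
move=> hP hq; pose a : arrow := existT _ P (existT _ Q q).
pose obj n := projT1 (res_arrow a n).
pose d n : {linear obj n.+1 -> obj n} := ker_cover (projT2 (projT2 (res_arrow a n))).
have hobj n : projective (obj n) by case: n => [|n] //; exact: free_projective.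
have ex0 : exact_at (d 0) q by exact: ker_cover_exact.
have exS n : exact_at (d n.+1) (d n) by exact: ker_cover_exact.
exists (@ProjectiveResolution R Q obj d q hobj hq ex0 exS).
by exists (idfun : {linear P -> P}), id.
Qed.

(** A free cover [e] of [G], followed by the projection to [G/N], starts a resolution. Then [phi]
    composed with [e] and the first differential is a cocycle. If it is the coboundary of [g], then
    [g] agrees with [phi] after [e] on the preimage of [N], hence kills the kernel of [e] and
    descends to [G]. *)
Lemma Ext1_extend (G X : lmodType R) (N : set G) (hN : submodule N)
    (phi : {linear subm hN -> X}) :
  Ext1_vanishes (quotm hN) X ->
  exists psi : {linear G -> X}, forall x, psi (subm_val x) = phi x.
Proof.
move=> hE; pose fl := free_lift (id : G -> G).
have flsurj y : exists x, (quotm_proj hN \o fl : {linear _ -> _}) x = y.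
  have [x <-] := quotm_proj_surj y; exists (gen R x).
  by rewrite /= free_lift_gen.
have [r [i [j [ri ij ji]]]] := free_resolution (@free_projective R G) flsurj.
pose e : {linear res_obj r 0 -> G} := fl \o i.
have kerN x : res_aug r x = 0 <-> N (e x) by rewrite ri; exact: quotm_proj_eq0.
have ex0 y : res_aug r y = 0 <-> exists v, res_diff r 0 v = y := @res_exact0 _ _ r y.
have dN v : N (e (res_diff r 0 v)) by apply/kerN/ex0; exists v.
pose f0 v := phi (subm_mk hN (dN v)).
have f0lin : linear f0.
  move=> a u v; rewrite /f0 -linearP; congr (phi _); apply: subm_val_inj.
  by rewrite [RHS]linearP !subm_mkK !linearP.
have [|g hg] := hE r (linear_of f0lin).
  move=> x; rewrite -[LHS]/(f0 _) /f0; rewrite -[RHS](linear0 phi); congr (phi _).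
  apply: subm_val_inj; rewrite subm_mkK linear0.
  by rewrite ((@res_exactS _ _ r 0 (res_diff r 1 x)).2 _) ?linear0 //; exists x.
have gE v : g (res_diff r 0 v) = f0 v by rewrite -hg.
have gker x (h : N (e x)) : g x = phi (subm_mk hN h).
  have /kerN/ex0 [v hv] := h; transitivity (f0 v); first by rewrite -hv gE.
  congr (phi _).
  by apply: subm_val_inj; rewrite !subm_mkK hv.
(* A set-theoretic section of [e]. Its failure to be linear lies in the kernel of [e], where [g]
   vanishes. *)
pose lift (y : G) := j (gen R y).
have eK y : e (lift y) = y by rewrite /= ji free_lift_gen.
have psilin : linear (g \o lift).
  move=> a x y /=; apply/eqP; rewrite -subr_eq0 -linearP -linearB; apply/eqP.
  have e0 : e (lift (a *: x + y) - (a *: lift x + lift y)) = 0.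
    by rewrite linearB linearP !eK subrr.
  have h : N (e (lift (a *: x + y) - (a *: lift x + lift y))).
    by rewrite e0; apply: submodule0.
  rewrite (gker _ h) -[RHS](linear0 phi); congr (phi _).
  by apply: subm_val_inj; rewrite subm_mkK e0 linear0.
exists (linear_of psilin) => x.
have h : N (e (lift (subm_val x))) by rewrite eK; apply: subm_valP.
rewrite -[LHS]/(g (lift (subm_val x))) (gker _ h); congr (phi _).
by apply: subm_val_inj; rewrite subm_mkK eK.
Qed.

End FreeResolution.

(** * Limits along filters *)

Section Noetherian.
Variables (R : comPzRingType).
Hypothesis noethR : noetherian R.

Definition fin_gen (M : lmodType R) (N : set M) : Prop :=
  exists (T : finType) (g : T -> M), (forall i, N (g i)) /\
    forall n, N n -> exists c : T -> R, n = \sum_i c i *: g i.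

Lemma ideal_fg (I : set R) : is_ideal I -> fin_gen (I : set R^o).
Proof.
move=> hI; have [s hs] := noethR hI.
exists 'I_(size s), (fun i : 'I_(size s) => s`_i); split.
  move=> i; rewrite hs; exists (fun j => (j == i)%:R).
  rewrite (bigD1 i) //= big1 => [|j ji]; first by rewrite eqxx mul1r addr0.
  by rewrite (negPf ji) mul0r.
by move=> n; rewrite {1}hs => -[c ->]; exists c.
Qed.

(** Induction on the coordinates that may be nonzero: lifts of generators of the ideal of [k]-th
    coordinates, together with generators of the vectors in [N] whose [k]-th coordinate is zero. *)
Lemma vector_fg (K : finType) (N : set (K -> R^o)) : submodule N -> fin_gen N.
Proof.
move=> hN; have : N `<=` [set f | forall k, k \notin enum K -> f k = 0].
  by move=> f _ k; rewrite mem_enum.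
elim: (enum K) N hN => [|k s IH] N hN Ns.
  exists void, (fun=> 0); split; first by case.
  move=> n /Ns hn; exists (fun=> 0); rewrite big_pred0 => [|[]].
  by apply: funext => j; exact: hn.
pose I : set R := [set a | exists2 f, N f & f k = a].
have hI : is_ideal I.
  split; first by exists 0 => //; exact: submodule0.
  move=> a _ _ [f hf <-] [g hg <-]; exists (a *: f + g) => //.
  by case: hN => _; apply.
have [T [a [ha hT]]] := ideal_fg hI.
have /choice [h hh] i : exists f, N f /\ f k = a i by have [f] := ha i; exists f.
pose N0 : set (K -> R^o) := [set f | N f /\ f k = 0].
have hN0 : submodule N0.
  split; first by split=> //; exact: submodule0.
  move=> b f g [Nf f0] [Ng g0]; split; first by case: hN => _; apply.
  by rewrite -[LHS]/(b * f k + g k) f0 g0 mulr0 addr0.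
have [|T' [g [hg hT']]] := IH N0 hN0.
  move=> f [Nf f0] j js; have [->//|jk] := eqVneq j k.
  by apply: (Ns f Nf j); rewrite inE negb_or jk.
exists (T + T')%type, (fun i => match i with inl i => h i | inr i => g i end); split.
  by case=> i; [case: (hh i)|case: (hg i)].
move=> n Nn; have [|c hc] := hT (n k); first by exists n.
have [|c' hc'] := hT' (n - \sum_i c i *: h i).
  split.
    apply: submoduleB => //; apply: submodule_sum => // i _.
    by apply: submoduleZ => //; case: (hh i).
  rewrite -[LHS]/(n k - (\sum_i c i *: h i) k) fct_sumE hc -sumrB big1 // => i _.
  by rewrite scalrfctE (hh i).2 subrr.
exists (fun i => match i with inl i => c i | inr i => c' i end).
by rewrite big_sumType /= -hc' addrC subrK.
Qed.

End Noetherian.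

Section Limits.
Variables (R : comPzRingType).

Definition limit_op (X : lmodType R) (I : Type) (F : set_system I) (L : (I -> X) -> X) :=
  linear L /\ forall f x, F [set i | f i = x] -> L f = x.

Definition has_limits (X : lmodType R) : Prop :=
  forall (I : Type) (F : set_system I), ProperFilter F -> exists L, @limit_op X I F L.

Hypothesis noethR : noetherian R.
Variables (X : lmodType R) (I : Type) (F : set_system I).
Hypotheses (fX : vflat X) (FF : ProperFilter F).

Definition germ_const : set (I -> X) := [set f | exists x, F [set i | f i = x]].

Lemma germ_const_submodule : submodule germ_const.
Proof.
split; first by exists 0; apply: filterS filterT.
move=> a f g [x hx] [y hy]; exists (a *: x + y).
by apply: filterS2 hx hy => i /= <- <-.
Qed.

(** Relations in the quotient say that almost all [f^~ i] solve one inhomogeneous system.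
    Subtracting the solution at a good index [i0] makes it homogeneous, and flatness of [X] solves
    it over the relation module [N]. Finitely many generators of [N] serve for all [i], so the
    solutions assemble into families. *)
Lemma vflat_germ_quot : vflat (quotm germ_const_submodule).
Proof.
move=> K T n q hq.
have /choice [f hf] t := quotm_proj_surj (q t).
have /choice [x hx] k : exists x, F [set i | \sum_t n t k *: f t i = x].
  have /quotm_proj_eq0 [x hx] : quotm_proj germ_const_submodule (\sum_t n t k *: f t) = 0.
    rewrite -[RHS](hq k) linear_sum; apply: eq_bigr => t _.
    by rewrite -hf; exact: linearZ.
  by exists x; apply: filterS hx => i /= <-; rewrite fct_sumE.
have FA := filter_forall (@filter_filter _ _ FF) hx.
have [i0 hi0] := filter_ex FA.
pose N : set (T -> R^o) := [set c | forall k, \sum_t c t * n t k = 0].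
have hN : submodule N.
  split; first by move=> k; rewrite big1 // => t _; exact: mul0r.
  move=> a u v hu hv k.
  transitivity (a * (\sum_t u t * n t k) + \sum_t v t * n t k); last first.
    by rewrite hu hv mulr0 addr0.
  by rewrite mulr_sumr -big_split; apply: eq_bigr => t _; rewrite /= mulrA -mulrDl.
have [G [g [hg hG]]] := vector_fg noethR hN.
have /choice [u hu] i : exists u : G -> X,
    (forall k, \sum_t n t k *: f t i = x k) ->
    forall t, f t i - f t i0 = \sum_j g j t *: u j.
  have [e|ne] := pselect (forall k, \sum_t n t k *: f t i = x k); last by exists (fun=> 0).
  have [|L [a [w [ha hw]]]] := fX (n := n) (x := fun t => f t i - f t i0).
    move=> k; under eq_bigr do rewrite scalerBr.
    by rewrite sumrB e hi0 subrr.
  have /choice [c hc] l : exists c : G -> R, (fun t => a t l) = \sum_j c j *: g j.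
    by apply: hG => k; exact: hw.
  exists (fun j => \sum_l c l j *: w l) => _ t.
  rewrite ha; under [RHS]eq_bigr do rewrite scaler_sumr.
  rewrite exchange_big; apply: eq_bigr => l _ /=.
  rewrite (congr1 (@^~ t) (hc l)) fct_sumE scaler_suml; apply: eq_bigr => j _.
  by rewrite scalerA mulrC.
exists G, (fun t j => g j t), (fun j => quotm_proj germ_const_submodule (u^~ j)).
split; last by move=> j k; exact: hg.
move=> t; rewrite -hf.
transitivity (quotm_proj germ_const_submodule (\sum_j g j t *: (u^~ j))); last first.
  by rewrite linear_sum; apply: eq_bigr => j _; rewrite linearZ.
apply/eqP; rewrite -subr_eq0 -linearB; apply/eqP/quotm_proj_eq0.
exists (f t i0); apply: filterS FA => i hi.
have := hu i hi t; rewrite -[LHS]/(f t i - f t i0) => e.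
rewrite /= -[LHS]/(f t i - (\sum_j g j t *: (u^~ j)) i) fct_sumE -[X in _ - X]e.
by rewrite opprB addrCA subrr addr0.
Qed.

(** Members of a proper filter meet, so an almost everywhere constant family has a unique value.
    This linear value map extends to all families. *)
Lemma limit_of_Ext : Ext1_vanishes (quotm germ_const_submodule) X ->
  exists L, @limit_op X I F L.
Proof.
move=> hE.
have val_uniq f x y : F [set i | f i = x] -> F [set i | f i = y] -> x = y :> X.
  by move=> hx hy; have [i [/= <- <-]] := filter_ex (filterI hx hy).
have /choice [v hv] (f : subm germ_const_submodule) :
  exists x, F [set i | subm_val f i = x] by have [x hx] := subm_valP f; exists x.
have vlin : linear v.
  move=> a f g; apply: val_uniq (hv (a *: f + g)) _.
  by apply: filterS2 (hv f) (hv g) => i /= <- <-.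
have [psi hpsi] := Ext1_extend (linear_of vlin) hE.
exists psi; split; first by move=> a f g; exact: linearP.
move=> f x hx; have h : germ_const f by exists x.
have e : v (subm_mk germ_const_submodule h) = x.
  by have := hv (subm_mk germ_const_submodule h); rewrite subm_mkK => /val_uniq; apply.
have := hpsi (subm_mk germ_const_submodule h); rewrite subm_mkK => ->; exact: e.
Qed.

End Limits.

Lemma flat_cotorsion_limits (R : comPzRingType) (X : lmodType R) :
  noetherian R -> flat_cotorsion X -> has_limits X.
Proof.
move=> noethR [fX cX] I F FF; have vX := flat_vflat fX.
apply: limit_of_Ext; apply: cX; apply: vflat_flat.
exact: vflat_germ_quot.
Qed.

(** * Detection by primes *)

Section Chains.
Variable U : Type.
Implicit Types (F : set (set U)) (P : set (set U)).

Lemma chain_finite (T : finType) F (n : T -> U) :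
  total_on F subset -> F !=set0 -> (forall i, (\bigcup_(A in F) A) (n i)) ->
  exists2 C, F C & forall i, C (n i).
Proof.
move=> tF [A0 FA0] h.
suff [C FC hC] : exists2 C, F C & forall i, i \in enum T -> C (n i).
  by exists C => // i; apply: hC; rewrite mem_enum.
elim: (enum T) => [|i s [C FC hC]]; first by exists A0.
have [A FA Ai] := h i.
have [CA|AC] := tF C A FC FA.
  by exists A => // j; rewrite inE => /predU1P[->//|/hC/CA].
by exists C => // j; rewrite inE => /predU1P[->|/hC//]; exact: AC.
Qed.

(** [set0] is adjoined to [P] to serve as the union of the empty chain; a maximal element cannot be
    [set0]. *)
Lemma Zorn_nonempty P : P !=set0 -> (forall A, P A -> A !=set0) ->
  (forall F, F `<=` P -> F !=set0 -> total_on F subset -> P (\bigcup_(A in F) A)) ->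
  exists2 A, P A & forall B, P B -> A `<=` B -> B `<=` A.
Proof.
move=> [A0 PA0] Pn Pchain; pose Q : set (set U) := [set A | A = set0 \/ P A].
have [|A [QA Amax]] := @Zorn_bigcup U Q.
  move=> F FQ tF; pose G := F `&` P.
  have eG : \bigcup_(A in F) A = \bigcup_(A in G) A.
    apply/seteqP; split=> x [A FA Ax]; last by exists A => //; case: FA.
    by case: (FQ A FA) => [A0'|PA]; [rewrite A0' in Ax|exists A].
  have [Gn|G0] := pselect (G !=set0); last first.
    by left; rewrite eG; apply/seteqP; split=> // x [A GA _]; case: G0; exists A.
  right; rewrite eG; apply: Pchain => //; first by move=> A [].
  by move=> A B [FA _] [FB _]; apply: tF.
have PA : P A.
  case: QA => // A0'; case: (Amax A0); last by right.
  rewrite A0'; split; first exact: sub0set.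
  by have [x A0x] := Pn _ PA0 => /(_ x A0x).
exists A => // B PB AB; apply: contrapT => nBA.
by apply: (Amax B); [split|right].
Qed.

End Chains.

Section Avoiding.
Variables (R : comPzRingType).

Lemma submodule_chain (M : lmodType R) (F : set (set M)) :
  F !=set0 -> total_on F subset -> (forall A, F A -> submodule A) ->
  submodule (\bigcup_(A in F) A).
Proof.
move=> [A0 FA0] tF hF; split; first by exists A0 => //; apply: submodule0; apply: hF.
move=> a x y [A FA Ax] [B FB By].
have [AB|BA] := tF A B FA FB.
  by exists B => //; case: (hF B FB) => _; apply=> //; apply: AB.
by exists A => //; case: (hF A FA) => _; apply=> //; apply: BA.
Qed.

(** Membership in [N X] involves finitely many elements of [N], so Zorn gives a maximal [N']. For
    [m] outside [N'], the vector [x] lies in [(N' + R m) X], and collecting the multiples of [m]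
    yields [z]. *)
Lemma maximal_avoiding (X : lmodType R) (K : finType) (N : set (K -> R^o)) x :
  submodule N -> ~ vmul X N x ->
  exists N' : set (K -> R^o), [/\ submodule N', N `<=` N', ~ vmul X N' x &
    forall m, ~ N' m -> exists z, vmul X N' (x - vscale m z)].
Proof.
move=> hN Nx.
have [||F hF Fn tF|A [hA NA Ax] Amax] := @Zorn_nonempty (K -> R^o)
  [set A | [/\ submodule A, N `<=` A & ~ vmul X A x]].
- by exists N; split.
- by move=> A [hA _ _]; exists 0; apply: submodule0.
- split.
  + by apply: submodule_chain => // A /hF[].
  + by have [A FA] := Fn => y Ny; exists A => //; case: (hF A FA) => _ + _; apply.
  + move=> [T [n [w [hn hx]]]]; have [C FC hC] := chain_finite tF Fn hn.
    by case: (hF C FC) => _ _; apply; exists T, n, w.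
exists A; split=> // m Am.
pose B : set (K -> R^o) := [set v | exists a : R, A (v - a *: m)].
have hB : submodule B.
  split; first by exists 0; rewrite scale0r subr0; apply: submodule0.
  move=> a u v [b hb] [c hc]; exists (a * b + c).
  rewrite scalerDl -scalerA opprD addrACA -scalerBr.
  by case: hA => _; apply.
have AB : A `<=` B by move=> v Av; exists 0; rewrite scale0r subr0.
have Bm : B m by exists 1; rewrite scale1r subrr; apply: submodule0.
have [[T [n [w [hn hx]]]]|nB] := pselect (vmul X B x); last first.
  case: Am; apply: (Amax B) => //; split=> //; exact: subset_trans NA AB.
have /choice [a ha] i : exists a : R, A (n i - a *: m) by exact: hn.
exists (\sum_i a i *: w i), T, (fun i => n i - a i *: m), w; split=> // k.
rewrite -[LHS]/(x k - m k *: _) hx scaler_sumr -sumrB; apply: eq_bigr => i _.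
by rewrite scalerA mulrC -scalerBl.
Qed.

(** A maximal ideal among the proper annihilators modulo [N] is prime. Unions of chains are attained
    because they are finitely generated. *)
Lemma exists_prime_annihilator (M : lmodType R) (N : set M) t0 : noetherian R ->
  submodule N -> ~ N t0 ->
  exists2 t, ~ N t & is_prime_ideal [set a : R | N (a *: t)].
Proof.
move=> noethR hN Nt0.
have colon t : is_ideal [set a : R | N (a *: t)].
  split; first by rewrite /= scale0r; apply: submodule0.
  by move=> a b c hb hc; rewrite /= scalerDl -scalerA; case: hN => _; apply.
have [||F hF Fn tF|A [t Nt ->] Amax] := @Zorn_nonempty R
  [set A | exists2 t, ~ N t & A = [set a | N (a *: t)]].
- by exists [set a | N (a *: t0)], t0.
- by move=> _ [t _ ->]; exists 0; rewrite /= scale0r; apply: submodule0.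
- have hU : is_ideal (\bigcup_(A in F) A).
    apply: (@submodule_chain R^o) => // A /hF[t _ ->]; exact: colon.
  have [T [g [hg hT]]] := ideal_fg noethR hU.
  have [C FC hC] := chain_finite tF Fn hg.
  have [t Nt eC] := hF C FC; exists t => //; rewrite -eC.
  apply/seteqP; split=> [x /hT[c ->]|x Cx]; last by exists C.
  by apply: (@submodule_sum R R^o) => [|i _]; [rewrite eC; exact: colon|];
    apply: (@submoduleZ R R^o) => //; rewrite eC; exact: colon.
exists t => //; split; first exact: colon.
  by rewrite /= scale1r.
move=> a b hab; have [|nb] := pselect (N (b *: t)); first by right.
(* The annihilator of [b *: t] contains that of [t] and is proper, so maximality makes them equal;
   it contains [a]. *)
left; apply: (Amax [set c | N (c *: (b *: t))]) => /=; first by exists (b *: t).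
  by move=> c /= hc; rewrite scalerA mulrC -scalerA; apply: submoduleZ.
by rewrite scalerA.
Qed.

(* The class of [x] in [X/pX] lies in [S_p(X)]. *)
Definition divisible_mod (X : lmodType R) (p : set R) : set X :=
  [set x | forall s, ~ p s -> exists y, imul X p (x - s *: y)].

Lemma divisible_mod_map (X Y : lmodType R) (f : {linear X -> Y}) p x :
  divisible_mod p x -> divisible_mod p (f x).
Proof.
move=> h s /h[y hy]; exists (f y).
by rewrite -linearZ -linearB; apply: imul_map.
Qed.

(** Take [t] with prime annihilator [p] modulo a maximal [N']. For [s] outside [p] also [s *: t] is
    outside [N'], so [x] is congruent both to [t z] and to [t s y]. The colon formula gives
    [z - s y] in [pX]; and [z] in [pX] would put [x] into [N' X]. *)
Lemma avoiding_prime (X : lmodType R) (K : finType) (N : set (K -> R^o)) x :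
  noetherian R -> vflat X -> submodule N -> ~ vmul X N x ->
  exists (N' : set (K -> R^o)) t z,
    [/\ submodule N', N `<=` N' & vmul X N' (x - vscale t z)] /\
    [/\ is_prime_ideal [set a | N' (a *: t)],
       divisible_mod [set a | N' (a *: t)] z & ~ imul X [set a | N' (a *: t)] z].
Proof.
move=> noethR fX hN Nx.
have [N' [hN' NN' N'x Nmax]] := maximal_avoiding hN Nx.
have hvN' := @vmul_submodule _ _ X _ hN'.
have [t0 Nt0] : exists t0, ~ N' t0.
  apply: contrapT => h; apply: N'x; rewrite -[x]vscale_basis.
  apply: submodule_sum => // k _; apply: vmul_gen.
  by apply: contrapT => hk; apply: h; exists (basis_vec R k).
have [t Nt pt] := exists_prime_annihilator noethR hN' Nt0.
have [z hz] := Nmax t Nt.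
exists N', t, z; split=> //; split=> //.
  move=> s hs; have [y hy] := Nmax (s *: t) hs; exists y.
  apply: vflat_colon => //; rewrite vscaleBr.
  have -> : vscale t (s *: y) = vscale (s *: t) y.
    by apply: funext => k; rewrite /vscale scalerA mulrC.
  have -> : vscale t z - vscale (s *: t) y =
      (x - vscale (s *: t) y) - (x - vscale t z).
    by rewrite opprB [RHS]addrC addrA subrK.
  exact: submoduleB.
move=> hp; apply: N'x; apply: (submodule_trans hvN' hz).
exact: vmul_imul hp.
Qed.

(** Injectivity of the maps induced on all [S_p], expressed on representatives. *)
Definition prime_injective (X Y : lmodType R) (f : X -> Y) : Prop :=
  forall p, is_prime_ideal p -> forall x, divisible_mod p x ->
    imul Y p (f x) -> imul X p x.

(** Otherwise [avoiding_prime] provides [z] nonzero in [S_p(X)], while [t f(z)] lies in [N' Y], so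
    that [f z] lies in [pY]. *)
Lemma prime_injective_pure (X Y : lmodType R) (f : {linear X -> Y}) (K : finType)
    (N : set (K -> R^o)) x :
  noetherian R -> vflat X -> vflat Y -> prime_injective f -> submodule N ->
  vmul Y N (f \o x) -> vmul X N x.
Proof.
move=> noethR fX fY finj hN hx; apply: contrapT => Nx.
have [N' [t [z [[hN' NN' hz] [pp hdiv npz]]]]] := avoiding_prime noethR fX hN Nx.
apply: npz; apply: finj => //; apply: vflat_colon => //.
have hvN' := @vmul_submodule _ _ Y _ hN'.
have -> : vscale t (f z) = (f \o x) - (f \o (x - vscale t z)).
  apply: funext => k; rewrite -[RHS]/(f (x k) - f (x k - t k *: z)).
  by rewrite linearB linearZ subKr.
apply: submoduleB => //; first exact: vmul_mono hx.
exact: vmul_map.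
Qed.

End Avoiding.

(** * Linear maps subject to congruences *)

Section LimitOperators.
Variables (R : comPzRingType) (X : lmodType R) (I : Type) (F : set_system I).
Hypothesis FF : ProperFilter F.
Variable L : (I -> X) -> X.
Hypothesis hL : limit_op F L.

Lemma limit_cst x : L (fun=> x) = x.
Proof. by apply: hL.2; apply: filterS filterT. Qed.

Lemma limit_ae f g : F [set i | f i = g i] -> L f = L g.
Proof.
move=> h; have := hL.1 (-1) g f; rewrite (hL.2 _ 0); last first.
  by apply: filterS h => i /= e; rewrite -[LHS]/(-1 *: g i + f i) e scaleN1r addNr.
by rewrite scaleN1r => /eqP; rewrite eq_sym addrC subr_eq0 => /eqP.
Qed.

(** Writing [f i - x] over fixed finitely many generators of the ideal lets the linear [L] pass to
    the coefficients. *)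
Lemma limit_imul (a : set R) f x : noetherian R -> is_ideal a ->
  F [set i | imul X a (f i - x)] -> imul X a (L f - x).
Proof.
move=> noethR ha h; have [T [g [hg hT]]] := ideal_fg noethR ha.
have /choice [u hu] i : exists u : T -> X,
    imul X a (f i - x) -> f i - x = \sum_j g j *: u j.
  have [[S [b [w [hb e]]]]|] := pselect (imul X a (f i - x)); last by exists (fun=> 0).
  have /choice [c hc] s : exists c : T -> R, b s = \sum_j c j *: g j by exact: hT.
  exists (fun j => \sum_s c s j *: w s) => _; rewrite e.
  under [RHS]eq_bigr do rewrite scaler_sumr.
  rewrite exchange_big; apply: eq_bigr => s _; rewrite hc scaler_suml.
  by apply: eq_bigr => j _; rewrite scalerA mulrC.
have -> : L f = x + \sum_j g j *: L (u^~ j).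
  have e : L (\sum_j g j *: u^~ j) = \sum_j g j *: L (u^~ j).
    exact: (linear_comb _ _ hL.1).
  have := hL.1 1 (fun=> x) (\sum_j g j *: u^~ j).
  rewrite !scale1r limit_cst e => <-; apply: limit_ae; apply: filterS h => i hi.
  by rewrite /= -[RHS]/(x + (\sum_j g j *: u^~ j) i) fct_sumE -(hu i hi) addrC subrK.
rewrite addrC addKr; exists T, g, (fun j => L (u^~ j)); split=> //.
Qed.

End LimitOperators.

Section Extension.
Variables (R : comPzRingType) (X Y : lmodType R).
Hypotheses (noethR : noetherian R) (fY : vflat Y) (limX : has_limits X).
Variables (J : choiceType) (I : J -> set R) (y : J -> Y) (x : J -> X).
Hypothesis hI : forall j, is_ideal (I j).
(* Used with [N] the sum of the [I (j k) e_k] and of the columns of a matrix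
   expressing the [y (j k)] in terms of finitely many elements of [Y]. *)
Hypothesis compat : forall (K : finType) (j : K -> J), injective j ->
  forall N : set (K -> R^o), submodule N ->
    (forall k a, I (j k) a -> N (a *: basis_vec R k)) ->
    vmul Y N (y \o j) -> vmul X N (x \o j).

Lemma sum_delta (T : finType) (M : lmodType R) (u : T) (f : T -> M) :
  \sum_e (e == u)%:R *: f e = f u.
Proof.
rewrite (bigD1 u) //= big1 => [|e eu]; first by rewrite eqxx scale1r addr0.
by rewrite (negPf eu) scale0r.
Qed.

(** The finitely many elements of [Y] involved are expanded over [w] so that their required
    relations hold coefficientwise. Any images [z] of the [w] then respect linearity, and the
    congruences become solvable for [z] by [compat]. *)
Lemma finite_extension (s : seq (R * Y * Y)) (r : seq J) :
  exists t : Y -> X,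
    (forall c, c \in s -> t (c.1.1 *: c.1.2 + c.2) = c.1.1 *: t c.1.2 + t c.2) /\
    (forall j, j \in r -> imul X (I j) (t (y j) - x j)).
Proof.
pose l := [seq c.1.2 | c <- s] ++ [seq c.2 | c <- s] ++
  [seq c.1.1 *: c.1.2 + c.2 | c <- s] ++ [seq y j | j <- r].
pose E := seq_sub l; pose C := seq_sub s; pose K := seq_sub r.
have h1 (c : C) : (val c).1.2 \in l.
  by rewrite !mem_cat; apply/or4P/Or41/(map_f (fun c => c.1.2) (ssvalP c)).
have h2 (c : C) : (val c).2 \in l.
  by rewrite !mem_cat; apply/or4P/Or42/(map_f (fun c => c.2) (ssvalP c)).
have h3 (c : C) : (val c).1.1 *: (val c).1.2 + (val c).2 \in l.
  rewrite !mem_cat; apply/or4P/Or43.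
  exact: (map_f (fun c => c.1.1 *: c.1.2 + c.2) (ssvalP c)).
have h4 (k : K) : y (val k) \in l.
  by rewrite !mem_cat; apply/or4P/Or44/(map_f y (ssvalP k)).
pose U1 c : E := SeqSub (h1 c); pose U2 c : E := SeqSub (h2 c).
pose U3 c : E := SeqSub (h3 c); pose V k : E := SeqSub (h4 k).
(* The relation [a u + v - (a u + v) = 0] for the constraint [c]. *)
pose n (e : E) (c : C) : R :=
  (val c).1.1 * (e == U1 c)%:R + (e == U2 c)%:R - (e == U3 c)%:R.
have hn (M : lmodType R) (f : E -> M) c :
    \sum_e n e c *: f e = (val c).1.1 *: f (U1 c) + f (U2 c) - f (U3 c).
  rewrite -(sum_delta (U1 c) f) -(sum_delta (U2 c) f) -(sum_delta (U3 c) f).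
  rewrite scaler_sumr -big_split -sumrB; apply: eq_bigr => e _ /=.
  by rewrite /n scalerBl scalerDl scalerA.
have [|L [a [w [ha hw]]]] := fY (n := n) (x := val).
  by move=> c; rewrite hn /= subrr.
have arel c m : a (U3 c) m = (val c).1.1 * a (U1 c) m + a (U2 c) m.
  have := hn R^o (a^~ m) c; rewrite [X in X = _](_ : _ = 0).
    by move/esym/eqP; rewrite subr_eq0 => /eqP.
  rewrite -[RHS](hw m c); apply: eq_bigr => e _; exact: mulrC.
pose N : set (K -> R^o) := [set v | exists c : L -> R,
  forall k, I (val k) (v k - \sum_m c m * a (V k) m)].
have hN : submodule N.
  split.
    exists (fun=> 0) => k; rewrite big1 => [|m _]; last by rewrite mul0r.
    by rewrite subr0; case: (hI (val k)).
  move=> b u v [c hc] [d hd]; exists (fun m => b * c m + d m) => k.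
  have [_ /(_ b _ _ (hc k) (hd k))] := hI (val k).
  congr (I _ _); rewrite mulrBr mulr_sumr addrACA -opprD -big_split.
  congr (_ - _); apply: eq_bigr => m _ /=.
  by rewrite mulrDl mulrA.
have := @compat K val val_inj N hN; case.
- move=> k b hb; exists (fun=> 0) => k'; rewrite big1 => [|m _]; last by rewrite mul0r.
  rewrite subr0 -[(b *: basis_vec R k) k']/(b * (k' == k)%:R); case: eqP => [->|_].
    by rewrite mulr1.
  by rewrite mulr0; case: (hI (val k')).
- exists L, (fun m k => a (V k) m), w; split; last by move=> k; exact: (ha (V k)).
  move=> m; exists (fun m' => (m' == m)%:R) => k.
  rewrite (sum_delta m (a (V k) : L -> R^o)) subrr.
  by case: (hI (val k)).
move=> T [v [om [hv hx]]].
have /choice [c hc] t : exists c : L -> R,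
  forall k, I (val k) (v t k - \sum_m c m * a (V k) m) by exact: hv.
pose z m := \sum_t c t m *: om t.
(* The value 0 off the finite list is harmless, since all constraints concern its elements. *)
pose t u := oapp (fun e : E => \sum_m a e m *: z m) 0 (insub u).
have tE e : t (val e) = \sum_m a e m *: z m by rewrite /t valK.
exists t; split.
  move=> b bs; pose b' : C := SeqSub bs.
  change (t (val (U3 b')) = (val b').1.1 *: t (val (U1 b')) + t (val (U2 b'))).
  rewrite !tE scaler_sumr -big_split.
  by apply: eq_bigr => m _ /=; rewrite arel scalerDl scalerA.
move=> j jr; pose k : K := SeqSub jr.
rewrite -[j]/(val k) -[y _]/(val (V k)) tE -opprB.
apply: submoduleN; first exact: imul_submodule.
exists T, (fun t => v t k - \sum_m c t m * a (V k) m), om; split=> //.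
rewrite -[x _]/((x \o val) k) hx.
under [in RHS]eq_bigr do rewrite scalerBl.
rewrite sumrB; congr (_ - _); under eq_bigr do rewrite scaler_sumr.
rewrite exchange_big; apply: eq_bigr => i _ /=; rewrite scaler_suml.
by apply: eq_bigr => m _; rewrite scalerA mulrC.
Qed.

(** Limit of the finite solutions along the filter of increasing finite systems: each single
    constraint eventually holds, and limits preserve it. *)
Lemma extension : exists t : {linear Y -> X}, forall j, imul X (I j) (t (y j) - x j).
Proof.
pose S := (seq (R * Y * Y) * seq J)%type.
pose B (i0 : S) : set S := [set i | {subset i0.1 <= i.1} /\ {subset i0.2 <= i.2}].
pose F := filter_from setT B.
have FF : ProperFilter F.
  apply: filter_from_proper => [|i _]; last by exists i; split.
  apply: filter_from_filter => [|i j _ _]; first by exists ([::], [::]).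
  exists (i.1 ++ j.1, i.2 ++ j.2) => // k [/= h1 h2].
  by split; split=> z hz; first [apply: h1|apply: h2]; rewrite mem_cat hz ?orbT.
have [L hL] := limX FF.
have /choice [t ht] i := finite_extension i.1 i.2.
pose T u := L (t^~ u).
have Tlin : linear T.
  move=> a u v; rewrite -(hL.1 a); apply: (limit_ae FF hL).
  exists ([:: (a, u, v)], [::]) => // i [/= h _].
  by apply: (ht i).1 (a, u, v) _; apply: h; rewrite inE.
exists (linear_of Tlin) => j; apply: (limit_imul FF hL) => //.
exists ([::], [:: j]) => // i [/= _ h].
by apply: (ht i).2; apply: h; rewrite inE.
Qed.

End Extension.

Section PrimeBijective.
Variables (R : comPzRingType).

Definition prime_surjective (X Y : lmodType R) (f : X -> Y) : Prop :=
  forall p, is_prime_ideal p -> forall y, divisible_mod p y ->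
    exists2 x, divisible_mod p x & imul Y p (y - f x).

Lemma imul0 (X : lmodType R) (x : X) : imul X [set 0] x -> x = 0.
Proof. by move=> [T [a [w [ha ->]]]]; rewrite big1 // => i _; rewrite ha scale0r. Qed.

Lemma zero_submodule (M : lmodType R) : submodule [set 0 : M].
Proof. by split=> // a x y -> ->; rewrite /= scaler0 addr0. Qed.

Lemma prime_injective_injective (X Y : lmodType R) (f : {linear X -> Y}) x :
  noetherian R -> vflat X -> vflat Y -> prime_injective f -> f x = 0 -> x = 0.
Proof.
move=> noethR fX fY finj fx0.
have h0 := zero_submodule (unit -> R^o).
have := @prime_injective_pure R X Y f unit [set 0] (fun=> x) noethR fX fY finj h0.
case; last by move=> T [n [w [hn /(_ tt) ->]]]; rewrite big1 // => i _; rewrite hn scale0r.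
have -> : f \o (fun=> x) = 0 :> (unit -> Y) by apply: funext => k; exact: fx0.
by apply: submodule0; apply: vmul_submodule.
Qed.

(** Purity of [f] makes the system for a linear retraction [r] of [f] compatible, with all ideals
    zero. Surjectivity on the [S_p] makes [r] injective on them, hence injective, so [r] is a
    two-sided inverse. *)
Lemma prime_bijective (X Y : lmodType R) (f : {linear X -> Y}) :
  noetherian R -> vflat X -> vflat Y -> has_limits X ->
  prime_injective f -> prime_surjective f -> exists2 g : {linear Y -> X}, cancel f g & cancel g f.
Proof.
move=> noethR fX fY limX finj fsurj.
have [||r hr] := @extension R X Y noethR fY limX X (fun=> [set 0]) f id.
- by move=> _; exact: (zero_submodule R^o).
- move=> K j _ N hN _ h; exact: (prime_injective_pure noethR fX fY finj hN h).
have rf x : r (f x) = x by apply/eqP; rewrite -subr_eq0; apply/eqP/imul0/hr.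
have rinj : prime_injective r.
  move=> p pp y hy ry; have [x hx yx] := fsurj p pp y hy.
  have hp : is_ideal p by case: pp.
  apply: (submodule_trans (imul_submodule Y hp) yx); apply: imul_map.
  rewrite -[x](subrK (r y)); apply: submoduleD => //; first exact: imul_submodule.
  rewrite -opprB; apply: submoduleN; first exact: imul_submodule.
  by rewrite -(rf x) -linearB; apply: imul_map.
exists r => // y; apply/eqP; rewrite -subr_eq0; apply/eqP.
by apply: (prime_injective_injective noethR fY fX rinj); rewrite linearB rf subrr.
Qed.

End PrimeBijective.

(** * Splitting one map *)

Section Ellis.
Variables (R : comPzRingType) (X Y : lmodType R) (d : X -> Y).
Hypothesis limX : has_limits X.

(** Closedness for pointwise limits along every filter and limit operator; this stands in for closed
    subsets of a compact space. *)
Definition limit_closed (A : set (Y -> X)) : Prop :=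
  forall (I : Type) (F : set_system I) (L : (I -> X) -> X),
    ProperFilter F -> limit_op F L ->
    forall t : I -> Y -> X, F [set i | A (t i)] -> A (fun u => L (t^~ u)).

Variable E : set (Y -> X).

Definition closed_subsemigroup (A : set (Y -> X)) : Prop :=
  [/\ A `<=` E, limit_closed A, A !=set0 & forall f g, A f -> A g -> A (f \o d \o g)].

Hypothesis hE : closed_subsemigroup E.

(** Zorn is applied to complements in [E], so that unions of chains correspond to intersections of
    subsemigroups. *)
Lemma minimal_subsemigroup : exists2 A, closed_subsemigroup A &
  forall B, closed_subsemigroup B -> B `<=` A -> A `<=` B.
Proof.
have [|B [hB Bmax]] := @Zorn_bigcup _ [set B | closed_subsemigroup (E `\` B)].
  move=> F hF tF; have [[B0 FB0]|F0] := pselect (F !=set0); last first.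
    have -> : \bigcup_(B in F) B = set0.
      by apply/seteqP; split=> // x [B FB _]; case: F0; exists B.
    by rewrite /= setD0.
  (* Along this filter the complements in [E] shrink, so a limit of elements chosen from each of
     them lies in all: the intersection is nonempty. *)
  pose G := filter_from F (fun B => [set B' | F B' /\ B `<=` B']).
  have GF : ProperFilter G.
    apply: filter_from_proper => [|B FB]; last by exists B; split.
    apply: filter_from_filter; first by exists B0.
    move=> B C FB FC; have [BC|CB] := tF B C FB FC.
      by exists C => // D [FD CD]; split; split=> //; apply: subset_trans CD.
    by exists B => // D [FD BD]; split; split=> //; apply: subset_trans BD.
  have /choice [f hf] B : exists f, F B -> (E `\` B) f.
    have [FB|] := pselect (F B); last by have [_ _ [f _] _] := hE; exists f.
    by have [_ _ [f hf] _] := hF B FB; exists f.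
  have notin g : (E `\` \bigcup_(B in F) B) g <-> forall B, F B -> (E `\` B) g.
    split=> [[Eg ng] B FB|h]; first by split=> // Bg; apply: ng; exists B.
    by split; [case: (h B0 FB0)|case=> B FB Bg; case: (h B FB)].
  split.
  - by move=> g [].
  - move=> I H L HF hL t ht; apply/(notin _) => B FB.
    have [_ hcl _ _] := hF B FB; apply: (hcl _ _ _ HF hL).
    by apply: filterS ht => i /(notin _); apply.
  - have [L hL] := limX GF; exists (fun u => L (f^~ u)); apply/(notin _) => B FB.
    have [_ hcl _ _] := hF B FB; apply: (hcl _ _ _ GF hL).
    exists B => // C [FC BC]; have [Ef nf] := hf C FC; split=> // Bf.
    exact/nf/BC.
  - move=> g h /(notin _) hg /(notin _) hh; apply/(notin _) => B FB.
    by have [_ _ _] := hF B FB; apply; [apply: hg|apply: hh].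
exists (E `\` B) => // A hA AB; have [AE _ _ _] := hA.
have eA : E `\` (~` A) = A.
  by rewrite setDE setCK; apply/seteqP; split=> x; [case|move=> Ax; split=> //; apply: AE].
move=> x [Ex nBx]; apply: contrapT => nAx.
apply: (Bmax (~` A)); last by rewrite /= eA.
split; first by move=> z Bz Az; case: (AB z Az).
by move=> h; apply: nBx; apply: h.
Qed.

(* The Ellis-Numakura argument: in a minimal closed subsemigroup [A], both
   [A * a] and [{f in A | f * a = a}] are all of [A]. *)
Lemma idempotent_exists : exists2 e, E e & e \o d \o e = e.
Proof.
have [A hA Amin] := minimal_subsemigroup.
have [AE Acl [a Aa] AM] := hA.
have hAa : closed_subsemigroup [set g | exists2 f, A f & g = f \o d \o a].
  split.
  - by move=> _ [f Af ->]; apply/AE/AM.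
  - move=> I F L FF hL t ht.
    have /choice [f hf] i : exists f, (exists2 f, A f & t i = f \o d \o a) ->
        A f /\ t i = f \o d \o a.
      have [[f Af e]|] := pselect (exists2 f, A f & t i = f \o d \o a); last by exists a.
      by exists f.
    exists (fun u => L (f^~ u)).
      by apply: (Acl _ _ _ FF hL); apply: filterS ht => i /hf[].
    apply: funext => u; apply: (limit_ae FF hL); apply: filterS ht => i /hf[_ e].
    by rewrite /= e.
  - by exists (a \o d \o a), a.
  - move=> _ _ [f Af ->] [g Ag ->]; exists (f \o d \o (a \o d \o g)) => //.
    exact: AM (AM _ _ Af Aa) Ag.
(* By minimality [A * a] is all of [A], so it contains [a]. *)
have [f0 Af0 ef0] : exists2 f, A f & a = f \o d \o a.
  by apply: (Amin _ hAa) => // _ [f Af ->]; apply: AM.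
have hB : closed_subsemigroup [set f | A f /\ f \o d \o a = a].
  split.
  - by move=> f [/AE].
  - move=> I F L FF hL t ht; split.
      by apply: (Acl _ _ _ FF hL); apply: filterS ht => i [].
    apply: funext => u; apply: hL.2; apply: filterS ht => i [_ e].
    by rewrite /= -[RHS](congr1 (@^~ u) e).
  - by exists f0.
  - move=> f g [Af ef] [Ag eg]; split; first exact: AM.
    by rewrite -[RHS]ef -[in RHS]eg.
have [|_ e] := Amin _ hB _ a Aa; first by move=> f [].
by exists a => //; apply: AE.
Qed.

End Ellis.

(** * Independent families and maps inverting [d] on them *)

Section PseudoInverse.
Variables (R : comPzRingType) (X Y : lmodType R).
Hypotheses (noethR : noetherian R) (fX : vflat X) (fY : vflat Y) (limX : has_limits X).
Variable d : {linear X -> Y}.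

(** Linear independence over [R/p] of the images under [d] in [Y/pY]. Indexing by a predicate lets
    single terms be dropped. *)
Definition independent (p : set R) (B : set X) : Prop :=
  B `<=` divisible_mod p /\
  forall (K : finType) (P : pred K) (b : K -> X) (a : K -> R),
    (forall k, P k -> B (b k)) -> {in P &, injective b} ->
    imul Y p (\sum_(k | P k) a k *: d (b k)) -> forall k, P k -> p (a k).

Lemma maximal_independent p : exists2 B, independent p B &
  forall B', B `<` B' -> ~ independent p B'.
Proof.
have [|B [hB Bmax]] := @Zorn_bigcup _ (independent p); last by exists B.
move=> F hF tF; split; first by move=> x [B /hF[+ _] Bx]; apply.
move=> K P b a hb binj hsum k0 Pk0.
have Fn : F !=set0 by have [C FC _] := hb k0 Pk0; exists C.
(* Indices outside [P] are replaced by [k0], whose value is known to lie in the union. *)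
have [|C FC hC] := chain_finite (n := fun k => b (if P k then k else k0)) tF Fn.
  by move=> k; case: ifP => [/hb|_] //; exact: hb.
have [_ hi] := hF C FC; apply: hi (hsum) _ Pk0 => // k Pk.
by have := hC k; rewrite Pk.
Qed.

Lemma prime_prod (p : set R) (K : finType) (P : pred K) (c : K -> R) :
  is_prime_ideal p -> (forall k, P k -> ~ p (c k)) -> ~ p (\prod_(k | P k) c k).
Proof.
move=> [_ p1 pM] hc; apply: (big_ind (fun r => ~ p r)) => //.
by move=> a b pa pb /pM[].
Qed.

Variable B : set R -> set X.
Hypothesis indepB : forall p, is_prime_ideal p -> independent p (B p).

Definition pinv_pred : {pred set R * X} :=
  [pred pb | `[< is_prime_ideal pb.1 /\ B pb.1 pb.2 >]].
Definition pinv_index : choiceType := {pb : set R * X | pinv_pred pb}.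

Lemma pinv_indexP (j : pinv_index) :
  is_prime_ideal (val j).1 /\ B (val j).1 (val j).2.
Proof. by have /asboolP := valP j. Qed.

(* For a maximal [N'] avoiding [b], the basis vectors [e k] whose annihilator
   modulo [N'] is exactly [p k] all have the same prime, and are proportional up
   to scalars outside it, so independence at that prime applies. *)
Lemma pinv_compat (K : finType) (j : K -> pinv_index) : injective j ->
  forall N : set (K -> R^o), submodule N ->
    (forall k a, (val (j k)).1 a -> N (a *: basis_vec R k)) ->
    vmul Y N (fun k => d (val (j k)).2) -> vmul X N (fun k => (val (j k)).2).
Proof.
move=> jinj N hN hpN hY; apply: contrapT => Nx.
pose p k := (val (j k)).1; pose b k := (val (j k)).2.
have pp k : is_prime_ideal (p k) by case: (pinv_indexP (j k)).
have bB k : B (p k) (b k) by case: (pinv_indexP (j k)).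
have [N' [hN' NN' N'x Nmax]] := maximal_avoiding hN Nx.
have hX := @vmul_submodule _ _ X _ hN'; have hvY := @vmul_submodule _ _ Y _ hN'.
pose e k : K -> R^o := basis_vec R k.
have peN k a : p k a -> N' (a *: e k) by move=> /hpN; apply: NN'.
have imN k z : imul X (p k) z -> vmul X N' (vscale (e k) z).
  by apply: vmul_imul => // a; apply: peN.
(* The annihilator of [e k] modulo [N'] contains [p k] by [peN]; [G] selects equality. *)
pose G k := `[< forall s, N' (s *: e k) -> p k s >].
(* Some [s] outside [p k] has [s *: e k] in [N'], and [b k] is divisible by [s] modulo [p k X]. *)
have notG k : ~~ G k -> vmul X N' (vscale (e k) (b k)).
  move=> /asboolPn; rewrite -existsNE => -[s /not_implyP[hs ps]].
  have [[/(_ _ (bB k)) + _] _] := (indepB (pp k), tt).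
  move=> /(_ s ps)[b' hb'].
  have -> : vscale (e k) (b k) = vscale (e k) (b k - s *: b') + vscale (s *: e k) b'.
    by rewrite vscaleBr -vscaleA subrK.
  by apply: submoduleD => //; [exact: imN|exact: vmul_gen].
have [k0 Gk0] : exists k, G k.
  apply: contrapT => nG; apply: N'x; rewrite -[X in vmul _ _ X]vscale_basis.
  apply: submodule_sum => // k _; apply: notG; apply/negP => Gk.
  by apply: nG; exists k.
have Gp k s : G k -> N' (s *: e k) -> p k s by move=> /asboolP; apply.
have eN k : G k -> ~ N' (e k).
  by move=> Gk h; case: (pp k) => _ + _; apply; apply: Gp => //; rewrite scale1r.
have [z0 hz0] := Nmax _ (eN _ Gk0).
have qz0 : ~ imul X (p k0) z0.
  move=> h; apply: N'x; apply: (submodule_trans hX hz0); exact: imN.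
have hac k : exists ac : R * R, G k ->
    [/\ ~ p k0 ac.1, ~ p k ac.2 & N' (ac.2 *: e k - ac.1 *: e k0)] /\ p k = p k0.
  have [Gk|nGk] := boolP (G k); last by exists (0, 0).
  have [z hz] := Nmax _ (eN _ Gk).
  (* Both vectors agree with the avoided one modulo [N' X]; flatness turns this into proportionality
     of [e k0] and [e k]. *)
  have h : vmul X N' (vscale (e k0) z0 - vscale (e k) z).
    have -> : vscale (e k0) z0 - vscale (e k) z =
        ((fun k => b k) - vscale (e k) z) - ((fun k => b k) - vscale (e k0) z0).
      by rewrite opprB [RHS]addrC addrA subrK.
    exact: submoduleB.
  have [L [a [c [w [hz0E hN'l]]]]] := vflat_colon2 fX hN' h.
  have [l pal] : exists l, ~ p k0 (a l).
    apply: contrapT => nl; apply: qz0; exists L, a, w; split=> // l.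
    by apply: contrapT => hl; apply: nl; exists l.
  have hl := hN'l l; have [_ _ p0M] := pp k0; have [_ _ pM] := pp k.
  have pcl : ~ p k (c l).
    move=> /peN hc; apply: pal; apply: Gp => //.
    exact: (submodule_trans hN' hl hc).
  have hl' : N' (c l *: e k - a l *: e k0) by rewrite -opprB; apply: submoduleN.
  exists (a l, c l) => _; split; first by split.
  (* As [c l *: e k] and [a l *: e k0] agree modulo [N'], an [r] killing one basis vector kills a
     multiple of the other by a scalar outside its prime. *)
  apply/seteqP; split=> r hr.
    have /(Gp _ _ Gk0)/p0M[] // : N' ((r * a l) *: e k0).
    rewrite -scalerA; apply: (submodule_trans (y := r *: (c l *: e k)) hN').
      by rewrite -scalerBr; apply: submoduleZ.
    by rewrite scalerA mulrC -scalerA; apply: submoduleZ => //; apply: peN.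
  have /(Gp _ _ Gk)/pM[] // : N' ((r * c l) *: e k).
  rewrite -scalerA; apply: (submodule_trans (y := r *: (a l *: e k0)) hN').
    by rewrite -scalerBr; apply: submoduleZ.
  by rewrite scalerA mulrC -scalerA; apply: submoduleZ => //; apply: peN.
have /choice [ac {}hac] := hac.
pose a k := (ac k).1; pose c k := (ac k).2.
(* Clearing denominators: with [C] the product of all [c k] over [G], [C *: e k] agrees with
   [a' k *: e k0] modulo [N']. *)
pose a' k := a k * \prod_(k' | G k' && (k' != k)) c k'.
have : imul Y (p k0) (\sum_(k | G k) a' k *: d (b k)).
  have : vmul Y N' (vscale (e k0) (\sum_(k | G k) a' k *: d (b k))).
    have hG : vmul Y N' (\sum_(k | G k) vscale (e k) (d (b k))).
      have h : vmul Y N' (\sum_k vscale (e k) (d (b k))).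
        by rewrite vscale_basis; exact: vmul_mono hY.
      rewrite (bigID G) /= in h.
      have hn : vmul Y N' (\sum_(k | ~~ G k) vscale (e k) (d (b k))).
        apply: submodule_sum => // k /notG/(vmul_map d).
        by congr vmul; apply: funext => i; rewrite /vscale /= linearZ.
      rewrite -[X in vmul _ _ X](addrK (\sum_(k | ~~ G k) vscale (e k) (d (b k)))).
      exact: submoduleB.
    pose C := \prod_(k | G k) c k.
    apply: (submodule_trans (y := C *: \sum_(k | G k) vscale (e k) (d (b k))) hvY);
      last exact: submoduleZ.
    have -> : vscale (e k0) (\sum_(k | G k) a' k *: d (b k)) =
        \sum_(k | G k) vscale (a' k *: e k0) (d (b k)).
      apply: funext => i; rewrite fct_sumE /vscale scaler_sumr; apply: eq_bigr => k _.
      by rewrite scalerA mulrC.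
    rewrite scaler_sumr -sumrB; apply: submodule_sum => // k Gk.
    have -> : vscale (a' k *: e k0) (d (b k)) - C *: vscale (e k) (d (b k)) =
        vscale (a' k *: e k0 - C *: e k) (d (b k)).
      rewrite vscaleBl; congr (_ - _); apply: funext => i.
      by rewrite /vscale scalrfctE scalerA.
    apply: vmul_gen; rewrite /a' /C [\prod_(i | G i) c i](bigD1 k) //=.
    rewrite [c k * _]mulrC [a k * _]mulrC -!scalerA.
    rewrite -scalerBr; apply: submoduleZ => //; rewrite -opprB; apply: submoduleN => //.
    by have [[]] := hac k Gk.
  move=> /(vflat_colon fY hN')[L [u [w [hu ->]]]]; exists L, u, w; split=> // i.
  exact: Gp _ _ Gk0 (hu i).
have [_ indep] := indepB (pp k0).
move=> /indep h.
have hB k : G k -> B (p k0) (b k) by move=> Gk; have [_ <-] := hac k Gk.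
have binj : {in G &, injective b}.
  move=> k k' Gk Gk' bk; apply: jinj; apply: val_inj.
  have [_ e1] := hac k Gk; have [_ e2] := hac k' Gk'.
  by rewrite [LHS]surjective_pairing [RHS]surjective_pairing -/(p k) -/(p k') e1 e2; congr pair.
(* Independence puts [a' k0] into [p k0], although none of its factors lies there. *)
have [_ _ pM] := pp k0; case/pM: (h hB binj k0 Gk0).
  by have [[]] := hac k0 Gk0.
apply: prime_prod => // k /andP[Gk _].
by have [[_ + _] <-] := hac k Gk.
Qed.

Lemma pinv_start : exists t : {linear Y -> X}, forall p, is_prime_ideal p ->
  forall b, B p b -> imul X p (t (d b) - b).
Proof.
have [||t ht] := @extension R X Y noethR fY limX pinv_index
  (fun j => (val j).1) (fun j => d (val j).2) (fun j => (val j).2).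
- by move=> j; have [[]] := pinv_indexP j.
- exact: pinv_compat.
exists t => p pp b Bb.
have hpb : pinv_pred (p, b) by apply/asboolP.
exact: (ht (exist _ (p, b) hpb)).
Qed.

End PseudoInverse.

(** Let [s] be an idempotent among the maps inverting [d] on every [B p]. Then [c = d - d s d]
    vanishes on [B p] modulo [p]. If [c x] were not in [pY], then applying [1 - d s] to a relation
    involving [x] would force the coefficient of [x] into [p], so [x] could be added to the maximal
    [B p]. *)
Lemma pseudo_inverse (R : comPzRingType) (X Y : lmodType R) (d : {linear X -> Y}) :
  noetherian R -> vflat X -> vflat Y -> has_limits X ->
  exists s : {linear Y -> X}, (forall y, s (d (s y)) = s y) /\
    forall p, is_prime_ideal p -> forall x, divisible_mod p x ->
      imul Y p (d x - d (s (d x))).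
Proof.
move=> noethR fX fY limX.
have /choice [B hB] p : exists B, independent d p B /\
    forall B', B `<` B' -> ~ independent d p B'.
  by have [B h1 h2] := maximal_independent d p; exists B.
have [t ht] := pinv_start noethR fX fY limX (fun p _ => (hB p).1).
pose E : set (Y -> X) := [set t | linear t /\ forall p, is_prime_ideal p ->
  forall b, B p b -> imul X p (t (d b) - b)].
have hE : closed_subsemigroup d E E.
  split=> //.
  - move=> I F L FF hL f hf; split.
      move=> a u v; rewrite -(hL.1 a); apply: (limit_ae FF hL).
      by apply: filterS hf => i [hlin _]; exact: hlin.
    move=> p pp b Bb; apply: (limit_imul FF hL) => //; first by case: pp.
    by apply: filterS hf => i [_]; apply.
  - by exists t; split=> // a u v; exact: linearP.
  - move=> f g [flin hf] [glin hg]; split.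
      by move=> a u v; rewrite /= glin linearP flin.
    move=> p pp b Bb; have hp := imul_submodule X (let: And3 ip _ _ := pp in ip).
    (* Here [f d g d b - b] is [f d (g d b - b)] plus [f d b - b]. *)
    apply: (submodule_trans (y := f (d b) - b) hp); last exact: hf.
    rewrite /= opprB addrA subrK.
    pose fd : {linear X -> X} := linear_of flin \o d.
    rewrite -[_ - _]/(fd (g (d b)) - fd b) -linearB.
    by apply: imul_map; apply: hg.
have [e [elin he] ede] := idempotent_exists limX hE.
pose s : {linear Y -> X} := linear_of elin.
exists s; split; first by move=> y; exact: (congr1 (@^~ y) ede).
move=> p pp x hx; have [[Bdiv indep] Bmax] := hB p.
have ip : is_ideal p by case: pp.
have hY := imul_submodule Y ip; have hX := imul_submodule X ip.
pose c u := d u - d (s (d u)).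
have cE u : c u = d (u - s (d u)) by rewrite linearB.
have cB b : B p b -> imul Y p (c b).
  move=> Bb; rewrite cE; apply: imul_map; rewrite -opprB.
  by apply: submoduleN => //; apply: he.
have [|nBx] := pselect (B p x); first exact: cB.
apply: contrapT => ncx; apply: (Bmax (x |` B p)).
  by split; [move=> z; right|move=> h; apply: nBx; apply: h; left].
split; first by move=> z [->|/Bdiv].
move=> K P b a hb binj hsum.
have [[k1 Pk1 bk1]|nk] := pselect (exists2 k, P k & b k = x); last first.
  apply: (indep K P b) => // k Pk; case: (hb k Pk) => // bx.
  by case: nk; exists k.
have hb' k : P k && (k != k1) -> B p (b k).
  move=> /andP[Pk kk1]; case: (hb k Pk) => // bx.
  by case/eqP: kk1; apply: binj => //; rewrite bk1.
have pak1 : p (a k1).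
  apply: contrapT => npa; apply: ncx; apply: (imul_prime fY pp npa).
  have hc : imul Y p (\sum_(k | P k) a k *: c (b k)).
    have -> : \sum_(k | P k) a k *: c (b k) = \sum_(k | P k) a k *: d (b k) -
        (d \o s : {linear _ -> _}) (\sum_(k | P k) a k *: d (b k)).
      rewrite linear_sum -sumrB; apply: eq_bigr => k _.
      by rewrite linearZ -scalerBr.
    by apply: submoduleB => //; apply: imul_map.
  rewrite (bigD1 k1) //= bk1 in hc.
  rewrite -[X in imul _ _ X](addrK (\sum_(k | P k && (k != k1)) a k *: c (b k))).
  apply: submoduleB => //; apply: submodule_sum => // k hk.
  by apply: submoduleZ => //; apply: cB; apply: hb'.
move=> k Pk; have [->//|kk1] := eqVneq k k1.
apply: (indep K [pred k | P k && (k != k1)] b) => //=; last by rewrite Pk.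
  by move=> i j /andP[Pi _] /andP[Pj _]; apply: binj.
rewrite (bigD1 k1) //= in hsum.
rewrite -[X in imul _ _ X](addKr (a k1 *: d (b k1))) addrC.
by apply: submoduleB => //; apply: imul_gen.
Qed.

(** * Splitting a complex *)

Section Retracts.
Variables (R : comPzRingType) (X Z : lmodType R).
Variables (i : {linear Z -> X}) (r : {linear X -> Z}).
Hypothesis ir : cancel i r.

Lemma retract_vflat : vflat X -> vflat Z.
Proof.
move=> fX K T n x hx; have [|L [a [w [ha hw]]]] := fX K T n (i \o x).
  move=> k; rewrite -[RHS](linear0 i) -(hx k) linear_sum; apply: eq_bigr => t _.
  by rewrite linearZ.
exists L, a, (r \o w); split=> // t; rewrite -[LHS]ir -[i _]/((i \o x) t) ha linear_sum.
by apply: eq_bigr => l _; rewrite linearZ.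
Qed.

Lemma retract_has_limits : has_limits X -> has_limits Z.
Proof.
move=> limX I F FF; have [L hL] := limX I F FF.
exists (fun f => r (L (i \o f))); split.
  move=> a f g; rewrite -linearP -hL.1; congr (r (L _)); apply: funext => k.
  exact: linearP.
by move=> f x hx; rewrite (hL.2 _ (i x)) ?ir //; apply: filterS hx => k /= ->.
Qed.

End Retracts.

Section Radical.
Variables (R : comPzRingType) (X : complex R).
Hypotheses (noethR : noetherian R) (fX : forall j, vflat (X j))
  (limX : forall j, has_limits (X j)).
Hypothesis rad : forall j p, is_prime_ideal p -> forall x, divisible_mod p x ->
  imul (X (j + 1)) p (diff X j x).

(** Homotopies are stated in degrees of the form [i + 1]; this reaches every degree without
    casts. *)
Lemma int_case (P : int -> Prop) : (forall i, P (i + 1)) -> forall j, P j.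
Proof. by move=> h j; rewrite -(subrK 1 j). Qed.

(** Both [d s] and [s d] vanish on every [S_p], so [h] acts there as the identity and
    [prime_bijective] applies. *)
Lemma homotopic_id_bijective (h : chain_map X X) : homotopic h (id_map X) ->
  forall j, exists2 k : {linear X j -> X j}, cancel (h j) k & cancel k (h j).
Proof.
move=> [s hs]; apply: int_case => i.
have hp p : is_prime_ideal p -> forall x, divisible_mod p x ->
    imul (X (i + 1)) p (h (i + 1) x - x).
  move=> pp x hx; have ip : is_ideal p by case: pp.
  rewrite hs; apply: submoduleD; first exact: imul_submodule.
    by apply: rad => //; apply: divisible_mod_map.
  by apply: imul_map; apply: rad.
apply: prime_bijective => // p pp x hx; have ip : is_ideal p by case: pp.
  have hX := imul_submodule (X (i + 1)) ip => hhx.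
  by rewrite -[x](subKr (h (i + 1) x)); apply: submoduleB => //; apply: hp.
exists x => //; rewrite -opprB; apply: submoduleN; first exact: imul_submodule.
exact: hp.
Qed.

(** Both composites of [f] with its homotopy inverse are bijective in each degree, hence so is [f];
    the degreewise inverse commutes with the differential. *)
Lemma radical_minimal : minimal X.
Proof.
move=> f [g [gf fg]].
have finv j : exists2 h : {linear X j -> X j}, cancel (f j) h & cancel h (f j).
  have [k k1 _] := homotopic_id_bijective gf j.
  have [k' _ k2'] := homotopic_id_bijective fg j.
  have fK : cancel (f j) (k \o g j : {linear _ -> _}) by move=> x; exact: k1.
  exists (k \o g j : {linear X j -> X j}) => // y.
  have ey : f j (g j (k' y)) = y by exact: k2'.
  by rewrite -[in LHS]ey fK.
pose h j := s2val (cid2 (finv j)).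
have fK j : cancel (f j) (h j) := s2valP (cid2 (finv j)).
have hK j : cancel (h j) (f j) := s2valP' (cid2 (finv j)).
have hE j x : h (j + 1) (diff X j x) = diff X j (h j x).
  by rewrite -{1}[x](hK j) -cmapE fK.
by exists (ChainMap hE); split.
Qed.

End Radical.

(** * The direct summand cut out by an idempotent chain map *)

Section Summand.
Variables (R : comPzRingType) (Y : complex R) (e : forall j, {linear Y j -> Y j}).
Hypothesis ee : forall j x, e j (e j x) = e j x.
Hypothesis ed : forall j x, e (j + 1) (diff Y j x) = diff Y j (e j x).

Lemma fixed_submodule j : submodule [set x | e j x = x].
Proof.
split; first exact: linear0.
by move=> a x y /= hx hy; rewrite linearP hx hy.
Qed.

(** The image of the idempotent [e j], given as its fixed points. *)
Definition summand_obj j : lmodType R := subm (fixed_submodule j).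

Definition summand_val j : {linear summand_obj j -> Y j} := subm_val.

Lemma summand_fixed j x : e j (summand_val j x) = summand_val j x.
Proof. exact: (subm_valP x). Qed.

Definition summand_proj_fun j (x : Y j) : summand_obj j :=
  subm_mk (fixed_submodule j) (ee x).

Lemma summand_proj_linear j : linear (@summand_proj_fun j).
Proof.
move=> a x y; apply: subm_val_inj.
by rewrite [RHS]linearP !subm_mkK linearP.
Qed.

Definition summand_proj j : {linear Y j -> summand_obj j} :=
  linear_of (@summand_proj_linear j).

Lemma summand_projE j x : summand_val j (summand_proj j x) = e j x.
Proof. exact: subm_mkK. Qed.

Lemma summand_valK j : cancel (summand_val j) (summand_proj j).
Proof. by move=> x; apply: subm_val_inj; rewrite summand_projE summand_fixed. Qed.

Definition summand_diff j : {linear summand_obj j -> summand_obj (j + 1)} :=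
  summand_proj (j + 1) \o (diff Y j \o summand_val j).

Lemma summand_diffE j x :
  summand_val (j + 1) (summand_diff j x) = diff Y j (summand_val j x).
Proof. by rewrite summand_projE ed summand_fixed. Qed.

Lemma summand_diffK j x : summand_diff (j + 1) (summand_diff j x) = 0.
Proof. by apply: subm_val_inj; rewrite summand_diffE summand_diffE diffK linear0. Qed.

Definition summand : complex R := Complex summand_diffK.

Lemma summand_proj_diff j x :
  summand_proj (j + 1) (diff Y j x) = summand_diff j (summand_proj j x).
Proof. by apply: subm_val_inj; rewrite summand_diffE !summand_projE ed. Qed.

Lemma summand_contractible (s : forall j, {linear Y (j + 1) -> Y j}) :
  (forall j x, e (j + 1) x = diff Y j (s j x) + s (j + 1) (diff Y (j + 1) x)) ->
  contractible summand.
Proof.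
move=> hs.
pose z : chain_map summand (zero_complex R) :=
  @ChainMap R summand (zero_complex R) (fun j => \0) (fun _ _ => erefl).
have z'E j (x : zero_complex R j) : (\0 : {linear zero_complex R (j + 1) -> summand (j + 1)})
    (diff (zero_complex R) j x) =
    diff summand j ((\0 : {linear zero_complex R j -> summand j}) x).
  exact: (esym (linear0 (diff summand j))).
exists z, (ChainMap z'E); split.
  (* The sign arises because the homotopy goes from the zero composite to the identity. *)
  exists (fun j => \- (summand_proj j \o (s j \o summand_val (j + 1)))) => j x.
  apply: (@subm_val_inj _ _ _ (fixed_submodule (j + 1))).
  pose u := summand_val (j + 1) x.
  have h1 : summand_val (j + 1) (summand_diff j (- summand_proj j (s j u))) =
      - e (j + 1) (diff Y j (s j u)).
    by rewrite linearN linearN summand_diffE summand_projE ed.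
  have h2 : summand_val (j + 1) (summand_proj (j + 1) (s (j + 1)
      (summand_val (j + 1 + 1) (summand_diff (j + 1) x)))) =
      e (j + 1) (s (j + 1) (diff Y (j + 1) u)).
    by rewrite summand_projE summand_diffE.
  transitivity (- u); first by rewrite linearB linear0 sub0r.
  transitivity (- e (j + 1) (diff Y j (s j u)) - e (j + 1) (s (j + 1) (diff Y (j + 1) u))).
    by rewrite -opprD -linearD -hs ee summand_fixed.
  by rewrite -h1 -h2 -linearB.
by exists (fun j => \0) => j x; rewrite thinmx0 [RHS]thinmx0.
Qed.

End Summand.

(* The only place where degrees [j] and [j - 1 + 1] are identified by a cast. *)
Lemma int_shift (P : int -> Type) (F : forall i : int, P (i + 1)) :
  exists G : forall j, P j, forall i, G (i + 1) = F i.
Proof.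
exists (fun j => eq_rect (j - 1 + 1) P (F (j - 1)) j (subrK 1 j)) => i.
move: (subrK 1 (i + 1)); have -> : i + 1 - 1 = i by rewrite addrK.
by move=> e; rewrite (eq_irrelevance e erefl).
Qed.

Lemma summand_split (R : comPzRingType) (Y : complex R)
    (e e' : forall j, {linear Y j -> Y j})
    (ee : forall j x, e j (e j x) = e j x) (ee' : forall j x, e' j (e' j x) = e' j x)
    (ed : forall j x, e (j + 1) (diff Y j x) = diff Y j (e j x))
    (ed' : forall j x, e' (j + 1) (diff Y j x) = diff Y j (e' j x)) :
  (forall j x, e' j x = x - e j x) ->
  exists f : chain_map Y (direct_sum (summand ee' ed') (summand ee ed)), is_iso f.
Proof.
move=> he.
pose A := summand ee' ed'; pose B := summand ee ed.
pose f0 j (x : Y j) : A j * B j := (summand_proj ee' j x, summand_proj ee j x).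
have f0lin j : linear (@f0 j) by move=> a x y; rewrite /f0 !linearP.
pose g0 j (p : A j * B j) : Y j := summand_val e' j p.1 + summand_val e j p.2.
have g0lin j : linear (@g0 j).
  move=> a p q; rewrite -[LHS]/(summand_val e' j (a *: p.1 + q.1) +
    summand_val e j (a *: p.2 + q.2)).
  by rewrite !linearP scalerDr addrACA.
have fE j x : linear_of (@f0lin (j + 1)) (diff Y j x) =
    diff (direct_sum A B) j (linear_of (@f0lin j) x).
  by congr pair; apply: summand_proj_diff.
have gE j p : linear_of (@g0lin (j + 1)) (diff (direct_sum A B) j p) =
    diff Y j (linear_of (@g0lin j) p).
  rewrite -[LHS]/(summand_val e' (j + 1) (summand_diff ee' j p.1) +
    summand_val e (j + 1) (summand_diff ee j p.2)).
  by rewrite !summand_diffE // -linearD.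
exists (@ChainMap R Y (direct_sum A B) (fun j => linear_of (@f0lin j)) fE).
exists (@ChainMap R (direct_sum A B) Y (fun j => linear_of (@g0lin j)) gE); split=> j.
  move=> x; rewrite -[LHS]/(summand_val e' j (summand_proj ee' j x) +
    summand_val e j (summand_proj ee j x)).
  by rewrite !summand_projE he subrK.
move=> [u v].
have ev : e j (summand_val e j v) = summand_val e j v by exact: summand_fixed.
have eu : e j (summand_val e' j u) = 0.
  have : e' j (summand_val e' j u) = summand_val e' j u by exact: summand_fixed.
  by rewrite he => /eqP; rewrite subr_eq addrC -subr_eq subrr eq_sym => /eqP.
congr pair; apply: subm_val_inj; rewrite [LHS]summand_projE ?he linearD eu ev add0r //.
by rewrite addrK.
Qed.

Theorem corollary2p4 (R : comPzRingType) (Y : complex R) :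
  noetherian R -> finite_krull_dim R ->
  (forall i : int, flat_cotorsion (Y i)) ->
  exists (Y' Y'' : complex R) (f : chain_map Y (direct_sum Y' Y'')),
    [/\ is_iso f, minimal Y' & contractible Y''].
Proof.
move=> noethR _ fcY.
have fY j : vflat (Y j) by apply: flat_vflat; case: (fcY j).
have limY j : has_limits (Y j) by apply: flat_cotorsion_limits.
have hs j := pseudo_inverse (diff Y j) noethR (fY j) (fY (j + 1)) (limY j).
pose s j : {linear Y (j + 1) -> Y j} := projT1 (cid (hs j)).
have sds j x : s j (diff Y j (s j x)) = s j x by exact: (projT2 (cid (hs j))).1.
have srad j := (projT2 (cid (hs j))).2 : forall p, is_prime_ideal p ->
  forall x, divisible_mod p x -> imul (Y (j + 1)) p (diff Y j x - diff Y j (s j (diff Y j x))).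
(* [q] is [d s] landing in degree [j], available in every degree. *)
have [q qE] := @int_shift (fun j => {linear Y j -> Y j})
  (fun j => diff Y j \o s j : {linear Y (j + 1) -> Y (j + 1)}).
have qS j x : q (j + 1) x = diff Y j (s j x) by rewrite qE.
have qq : forall j x, q j (q j x) = q j x.
  by apply: int_case => j x; rewrite !qS sds.
have dq : forall j x, diff Y j (q j x) = 0.
  by apply: int_case => j x; rewrite qS diffK.
(* [e = d s' + s' d] for [s' = (1 - d s) s]. *)
pose e j : {linear Y j -> Y j} :=
  (q j \+ (s j \o diff Y j)) \- (q j \o (s j \o diff Y j)).
have eE j x : e j x = q j x + s j (diff Y j x) - q j (s j (diff Y j x)) by [].
have de j x : diff Y j (e j x) = diff Y j (s j (diff Y j x)).
  by rewrite eE linearB linearD !dq add0r subr0.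
have ed j x : e (j + 1) (diff Y j x) = diff Y j (e j x).
  by rewrite de eE diffK !linear0 !addr0 qS.
have ee j x : e j (e j x) = e j x.
  (* By [d e = d s d] and [s d s = s] only [q e = q] remains, which follows from [q q = q]. *)
  by rewrite [LHS]eE de sds [in q j (e j x)]eE linearB linearD !qq addrK eE.
pose e' j : {linear Y j -> Y j} := idfun \- e j.
have e'E j x : e' j x = x - e j x by [].
have ed' j x : e' (j + 1) (diff Y j x) = diff Y j (e' j x).
  by rewrite !e'E ed -linearB.
have ee' j x : e' j (e' j x) = e' j x.
  have h : e j (e' j x) = 0 by rewrite e'E (linearB (e j)) ee subrr.
  by rewrite [LHS]e'E h subr0.
have [f fiso] := summand_split ee ee' ed ed' e'E.
exists (summand ee' ed'), (summand ee ed), f; split=> //.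
  apply: radical_minimal => // [j|j|j p pp x hx].
  - exact: retract_vflat (summand_valK ee' (j := j)) (fY j).
  - exact: retract_has_limits (summand_valK ee' (j := j)) (limY j).
  - have hp := imul_submodule (Y (j + 1)) (let: And3 ip _ _ := pp in ip).
    have vx : e' j (summand_val e' j x) = summand_val e' j x by exact: summand_fixed.
    apply: (imul_map (summand_proj ee' (j + 1))).
    (* On the kernel of [e], [d] equals [d - d s d], since [d e = d s d]. *)
    have := srad j p pp _ (divisible_mod_map (summand_val e' j) hx).
    by rewrite -de -linearB -e'E vx.
apply: (@summand_contractible _ _ _ _ _ (fun j => (s j \- (q j \o s j)))) => j x.
(* As [d q = 0], the term [d s'] reduces to [d s = q]. *)
rewrite /= linearB dq subr0 qS.
by rewrite addrA.
Qed.
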